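(* Let $q=2^h$, $h>5$. A KM-arc $\mathcal{A}$ of type $q/16$ in $\mathrm{PG}(2,q)$ arising from the construction described in the context (for some admissible tuple) exists if and only if one of the following holds: (1) $4\mid h$ and $\mathcal{A}$ is $\mathrm{P\Gamma L}$-equivalent to the KM-arc constructed from an admissible tuple $(\alpha_{1},\alpha_{2},\alpha_{3},1)$ with $\langle\alpha_{1},\alpha_{2},\alpha_{3},1\rangle=\mathbb{F}_{16}\subset\mathbb{F}_{q}$; (2) $6\mid h$ and $\mathcal{A}$ is $\mathrm{P\Gamma L}$-equivalent to the KM-arc constructed from an admissible tuple $(\alpha_{1},\alpha_{2},\alpha_{3},1)$ with $\langle\alpha_{1},\alpha_{2},\alpha_{3},1\rangle=\langle\mathbb{F}_{4},\mathbb{F}_{8}\rangle\subseteq\mathbb{F}_{q}$; (3) $7\mid h$ and $\mathcal{A}$ is $\mathrm{P\Gamma L}$-equivalent to the KM-arc constructed from the admissible tuple $(z,z^{2},z^{4},1)$ with $z\in\mathbb{F}_{q}$ satisfying $z^{7}=z+1$, or to the KM-arc constructed from the admissible tuple $(z^{11},z^{22},z^{44},1)$ with $z\in\mathbb{F}_{q}$ satisfying $z^{7}=z+1$. That is: every KM-arc arising from the construction for some admissible tuple in $\mathbb{F}_q$ satisfies (1), (2) or (3); and conversely, if $4\mid h$, $6\mid h$ or $7\mid h$, the corresponding tuples listed in (1), (2), (3) respectively exist in $\mathbb{F}_q$ and are admissible.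
   Context: $\mathrm{Tr}$ is the absolute trace $\mathbb{F}_q\to\mathbb{F}_2$; $\langle\cdot\rangle$ denotes the additive subgroup ($\mathbb{F}_2$-span) generated in $\mathbb{F}_q$; subfields are regarded as additive subgroups of $\mathbb{F}_q$. A KM-arc of type $t$ in $\mathrm{PG}(2,q)$ is a set of $q+t$ points such that every line meets it in $0$, $2$ or $t$ points (each value occurring). Two KM-arcs are $\mathrm{P\Gamma L}$-equivalent if some element of $\mathrm{P\Gamma L}(3,q)$ (a collineation) maps one onto the other. The construction. A tuple $(\alpha_1,\alpha_2,\alpha_3,\alpha_4)$ of elements of $\mathbb{F}_q^*$ is admissible if the $\alpha_i$ are $\mathbb{F}_2$-independent and $\alpha_i^2/\alpha_4\in\langle\alpha_1,\alpha_2,\alpha_3,\alpha_4\rangle$ for $i=1,2,3$. Given an admissible tuple, let $S=\{x\in\mathbb{F}_q\mid \mathrm{Tr}(\alpha_ix)=0,\ i=1,2,3,4\}$, let $\alpha\in\langle\alpha_1,\alpha_2,\alpha_3,\alpha_4\rangle$ be such that $\{\alpha_1(\alpha_1+\alpha_4),\alpha_2(\alpha_2+\alpha_4),\alpha_3(\alpha_3+\alpha_4),\alpha_4\alpha\}$ is $\mathbb{F}_2$-independent, let $\beta_1,\beta_2,\beta_3\in\mathbb{F}_q^*$ satisfy $\mathrm{Tr}(\alpha_i\beta_j)=\delta_{i,j}$ for $i=1,\dots,4$, $j=1,2,3$, and let $f_1(x,y,z)=x+y+z+yz$, $f_2(x,y,z)=y+z+xz$, $f_3(x,y,z)=z+xy$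 as functions $\mathbb{F}_2^3\to\mathbb{F}_2$. The constructed KM-arc is the union of $\{(0,1,x)\mid \mathrm{Tr}(\alpha_i(\alpha_i+\alpha_4)x)=0,\ i=1,2,3,\ \mathrm{Tr}(\alpha_4\alpha x)=1\}$ and of the sets $\{(1,\sum_{i=1}^4\lambda_i\alpha_i,\sum_{i=1}^3f_i(\lambda_1,\lambda_2,\lambda_3)\beta_i+s)\mid s\in S\}$ for all $(\lambda_1,\dots,\lambda_4)\in\mathbb{F}_2^4$. Such $\alpha$ and $\beta_j$ always exist, the resulting set does not depend on their choice, and it is a KM-arc of type $q/16$ in $\mathrm{PG}(2,q)$. *)

(* Defs.v *)
From HB Require Import structures.
From mathcomp Require Import all_boot all_order all_algebra all_fingroup all_field.

Set Implicit Arguments.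
Unset Strict Implicit.
Unset Printing Implicit Defensive.

Import GRing.Theory.
Local Open Scope ring_scope.

Section Defs.

Variable F : finFieldType.

Implicit Types (x y z a b : F) (A B : {set {set 'rV[F]_3}}).

(* The absolute trace of a field of order 2 ^ h; its values 0, 1 in 'F_2 are
   seen as elements of F. *)
Definition Tr x : F := \sum_(i < logn 2 #|F|) x ^+ (2 ^ i).

(* Elements of 'F_2 are coerced to the naturals 0, 1 and act on F by *+, which
   is the 'F_2-scalar multiplication when F has characteristic 2. *)
Definition F2_independent n (s : n.-tuple F) : Prop :=
  forall l : 'I_n -> 'F_2,
    \sum_(i < n) tnth s i *+ l i = 0 -> forall i, l i = 0.

(* <<_>> is taken in the finGroupType that every finZmodType carries, whose
   law is the addition of F. *)
Definition add_span (X : {set F}) : {set F} := <<X>>%g.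

Definition span4 a1 a2 a3 a4 : {set F} := add_span [set a1; a2; a3; a4].

Definition is_subfield (n : nat) (K : {set F}) : Prop :=
  divring_closed K /\ #|K| = n.

(* Points of PG(2, q) are the 1-dimensional subspaces of F^3, as sets of row
   vectors; the line with coordinates u is the set of points on which the
   linear form u vanishes. *)
Definition row3 x y z : 'rV[F]_3 := \row_(i < 3) tnth [tuple x; y; z] i.

Definition point (v : 'rV[F]_3) : {set 'rV[F]_3} := [set k *: v | k : F].

Definition PG2 : {set {set 'rV[F]_3}} := [set point v | v : 'rV[F]_3 & v != 0].

Definition line (u : 'cV[F]_3) : {set {set 'rV[F]_3}} :=
  [set P in PG2 | P \subset [set v | v *m u == 0]].

Definition KM_arc (t : nat) A : Prop :=
  [/\ A \subset PG2,
      #|A| = (#|F| + t)%N,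
      forall u : 'cV[F]_3, u != 0 -> #|A :&: line u| \in [:: 0; 2; t]%N
    & forall m, m \in [:: 0; 2; t]%N ->
        exists2 u : 'cV[F]_3, u != 0 & #|A :&: line u| = m].

(* An endomorphism of a finite field is automatically an automorphism. *)
Definition collineation (sigma : {rmorphism F -> F}) (M : 'M[F]_3)
    (P : {set 'rV[F]_3}) : {set 'rV[F]_3} :=
  [set map_mx sigma v *m M | v in P].

Definition PGammaL_equiv A B : Prop :=
  exists (sigma : {rmorphism F -> F}) (M : 'M[F]_3),
    M \in unitmx /\ B = [set collineation sigma M P | P in A].

Definition admissible a1 a2 a3 a4 : Prop :=
  [/\ [/\ a1 != 0, a2 != 0, a3 != 0 & a4 != 0],
      F2_independent [tuple a1; a2; a3; a4]
    & [/\ a1 ^+ 2 / a4 \in span4 a1 a2 a3 a4,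
          a2 ^+ 2 / a4 \in span4 a1 a2 a3 a4
        & a3 ^+ 2 / a4 \in span4 a1 a2 a3 a4]].

Definition setS a1 a2 a3 a4 : {set F} :=
  [set x | [&& Tr (a1 * x) == 0, Tr (a2 * x) == 0,
               Tr (a3 * x) == 0 & Tr (a4 * x) == 0]].

Definition alpha_choice a1 a2 a3 a4 a : Prop :=
  a \in span4 a1 a2 a3 a4 /\
  F2_independent [tuple a1 * (a1 + a4); a2 * (a2 + a4); a3 * (a3 + a4); a4 * a].

Definition beta_choice a1 a2 a3 a4 b1 b2 b3 : Prop :=
  [/\ b1 != 0, b2 != 0, b3 != 0
    & forall (i : 'I_4) (j : 'I_3),
        Tr (tnth [tuple a1; a2; a3; a4] i * tnth [tuple b1; b2; b3] j)
        = (i == j :> nat)%:R].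

Definition f1 (x y z : 'F_2) : 'F_2 := x + y + z + y * z.
Definition f2 (x y z : 'F_2) : 'F_2 := y + z + x * z.
Definition f3 (x y z : 'F_2) : 'F_2 := z + x * y.

Definition KM_set_inf a1 a2 a3 a4 a : {set {set 'rV[F]_3}} :=
  [set point (row3 0 1 x) | x : F &
     [&& Tr (a1 * (a1 + a4) * x) == 0, Tr (a2 * (a2 + a4) * x) == 0,
         Tr (a3 * (a3 + a4) * x) == 0 & Tr (a4 * a * x) == 1]].

Definition KM_set_aff a1 a2 a3 a4 b1 b2 b3 (l1 l2 l3 l4 : 'F_2) :
    {set {set 'rV[F]_3}} :=
  [set point (row3 1 (a1 *+ l1 + a2 *+ l2 + a3 *+ l3 + a4 *+ l4)
                     (b1 *+ f1 l1 l2 l3 + b2 *+ f2 l1 l2 l3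
                      + b3 *+ f3 l1 l2 l3 + s)) | s in setS a1 a2 a3 a4].

Definition KM_set a1 a2 a3 a4 a b1 b2 b3 : {set {set 'rV[F]_3}} :=
  KM_set_inf a1 a2 a3 a4 a :|:
  \bigcup_(l1 : 'F_2) \bigcup_(l2 : 'F_2) \bigcup_(l3 : 'F_2)
    \bigcup_(l4 : 'F_2) KM_set_aff a1 a2 a3 a4 b1 b2 b3 l1 l2 l3 l4.

(* A is the set obtained from an admissible tuple, for some choice of the
   auxiliary elements a and b1, b2, b3 (which do not affect the result). *)
Definition constructed_from a1 a2 a3 a4 A : Prop :=
  admissible a1 a2 a3 a4 /\
  exists a b1 b2 b3,
    [/\ alpha_choice a1 a2 a3 a4 a, beta_choice a1 a2 a3 a4 b1 b2 b3
      & A = KM_set a1 a2 a3 a4 a b1 b2 b3].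

Definition arises_from_construction A : Prop :=
  exists a1 a2 a3 a4, constructed_from a1 a2 a3 a4 A.

Definition equiv_to_constructed a1 a2 a3 a4 A : Prop :=
  exists2 B, constructed_from a1 a2 a3 a4 B & PGammaL_equiv A B.

Definition spans_F16 a1 a2 a3 a4 : Prop :=
  exists2 K16 : {set F}, is_subfield 16 K16 & span4 a1 a2 a3 a4 = K16.

Definition spans_F4_F8 a1 a2 a3 a4 : Prop :=
  exists K4 K8 : {set F},
    [/\ is_subfield 4 K4, is_subfield 8 K8
      & span4 a1 a2 a3 a4 = add_span (K4 :|: K8)].

End Defs.

(* Main.v *)
(* Dividing an admissible tuple by a4, which is the effect of a collineation, makes its span V a
   4-dimensional F_2-space that contains 1 and is stable under squaring.  By Cayley-Hamilton the
   Frobenius map on V satisfies a monic polynomial f of degree 4 over F_2, so V is the full root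
   set of an additive polynomial of degree 16; f has nonzero constant term because that polynomial
   has 16 roots, and f(1) = 0 because 1 is in V.  The four candidates are X^4 + 1,
   (X + 1)^2 (X^2 + X + 1), (X + 1) (X^3 + X + 1) and (X + 1) (X^3 + X^2 + 1); they divide X^4 - 1,
   X^6 - 1, X^7 - 1 and X^7 - 1, and give F_16, <F_4, F_8> and the two tuples over F_128.  In the
   last two cases the tuple at hand may be any basis of V: a change of basis modifies the functions
   f_i by an alternating form on V / <1>, and since the products of pairs of basis elements are
   independent modulo V, this form is Tr (c x y) for some c and is undone by the shear
   z |-> z + c y.

   For the arc property, a line z = m y + b meets the affine part in the solutions of a system in
   the four coordinates over F_2 that only involves the bits Tr (m a_i a_j) and Tr (b a_i); the
   numbers of solutions are computed for all values of these bits. *)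

Require Import Defs.
From HB Require Import structures.
From mathcomp Require Import all_boot all_order all_algebra all_fingroup all_field zify ring.

Set Implicit Arguments.
Unset Strict Implicit.
Unset Printing Implicit Defensive.

Import GRing.Theory.
Local Open Scope ring_scope.

(** * Frobenius powers, roots and traces in characteristic 2 *)

Lemma exprn_fix_mul (R : pzRingType) (x : R) p a u :
  x ^+ (p ^ a) = x -> x ^+ (p ^ (a * u)) = x.
Proof.
move=> xa; elim: u => [|u IH]; first by rewrite muln0.
by rewrite mulnS expnD exprM xa.
Qed.

(** By Bezout there are [u], [v] with [u * a = v * b + gcdn a b], and the powers with exponents
    [p ^ (u * a)] and [p ^ (v * b)] both fix [x]. *)
Lemma exprn_fix_gcd (R : pzRingType) (x : R) p a b :
  x ^+ (p ^ a) = x -> x ^+ (p ^ b) = x -> x ^+ (p ^ gcdn a b) = x.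
Proof.
case: (posnP a) => [-> _|a0 xa xb]; first by rewrite gcd0n.
case: (egcdnP b a0) => u v Duv _.
have := exprn_fix_mul u xa; rewrite mulnC Duv expnD exprM.
by rewrite mulnC (exprn_fix_mul v xb).
Qed.

(** ['X^#|F| - 'X] is the product of the distinct factors ['X - a], so a divisor is, up to a unit,
    the product over a subset of the field. *)
Lemma card_roots_of_split (F : finFieldType) (L : {poly F}) :
  L %| 'X^#|F| - 'X -> #|[set x | root L x]| = (size L).-1.
Proof.
rewrite finField_genPoly => /dvdp_prod_XsubC[m Lm].
rewrite (eqp_size Lm) size_prod_XsubC /=.
rewrite -(card_uniqP (mask_uniq (index_enum_uniq F) m)); apply: eq_card => x.
by rewrite inE (eqp_root Lm) root_prod_XsubC.
Qed.

Lemma card_roots_lt (R : finFieldType) (p : {poly R}) (A : {set R}) :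
  p != 0 -> {in A, forall x, root p x} -> (#|A| < size p)%N.
Proof.
move=> p0 Ap; rewrite cardE; apply: max_poly_roots => //; last exact: enum_uniq.
by apply/allP => x; rewrite mem_enum => /Ap.
Qed.

Section Char2.
Variables (F : finFieldType) (h : nat).
Hypothesis cardF : #|F| = (2 ^ h)%N.

Lemma char2 : 2%N \in [pchar F].
Proof. exact: card_finPcharP cardF _. Qed.

Lemma addff (x : F) : x + x = 0.
Proof. exact: addrr_pchar2 char2 x. Qed.

Lemma oppf2 (x : F) : - x = x.
Proof. exact: oppr_pchar2 char2 x. Qed.

Lemma eqf2 (x y : F) : (x == y) = (x + y == 0).
Proof. by rewrite -subr_eq0 oppf2. Qed.
Lemma addff_eq (x y : F) : x + y = 0 -> x = y.
Proof. by move/eqP; rewrite -eqf2 => /eqP. Qed.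

Lemma frobD k (x y : F) : (x + y) ^+ (2 ^ k) = x ^+ (2 ^ k) + y ^+ (2 ^ k).
Proof. by rewrite exprDn_pchar // pnatX pnatE // char2. Qed.

Lemma frob_fix (x : F) : x ^+ (2 ^ h) = x.
Proof. by rewrite -cardF expf_card. Qed.

Lemma sqrfD (x y : F) : (x + y) ^+ 2 = x ^+ 2 + y ^+ 2.
Proof. exact: (frobD 1). Qed.

Lemma sqrf_inj : injective (fun x : F => x ^+ 2).
Proof.
move=> x y /eqP; rewrite eqf2 -sqrfD expf_eq0 /= -eqf2 => /eqP; exact.
Qed.

Lemma frobD_poly k (p q : {poly F}) : (p + q) ^+ (2 ^ k) = p ^+ (2 ^ k) + q ^+ (2 ^ k).
Proof.
rewrite exprDn_pchar // pnatX; apply/orP; left.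
by rewrite pnatE // pchar_lalg char2.
Qed.

Lemma dvdp_frob_fix d e : (d %| e)%N -> ('X^(2 ^ d) - 'X : {poly F}) %| 'X^(2 ^ e) - 'X.
Proof.
case/dvdnP=> k ->; elim: k => [|k IH]; first by rewrite mul0n subrr dvdp0.
have -> : 'X^(2 ^ (k.+1 * d)) - 'X = ('X^(2 ^ (k * d)) - 'X) ^+ (2 ^ d) + ('X^(2 ^ d) - 'X) :>
  {poly F}.
  have N (p : {poly F}) : - p = p by apply: oppr_pchar2; rewrite pchar_lalg char2.
  have A (p : {poly F}) : p + p = 0 by apply: addrr_pchar2; rewrite pchar_lalg char2.
  by rewrite !N frobD_poly -exprM -expnD -addrA [_ + (_ + 'X)]addrA A add0r mulSn addnC.
by rewrite dvdp_add // (dvdp_trans IH) // dvdp_exp // expn_gt0.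
Qed.

Lemma size_frob_fix d : (0 < d)%N -> size ('X^(2 ^ d) - 'X : {poly F}) = (2 ^ d).+1.
Proof.
move=> d0; rewrite size_polyDl size_polyXn // size_polyN size_polyX.
rewrite ltnS; apply: (leq_ltn_trans d0); exact: ltn_expl.
Qed.

Lemma card_frob_fix d : (0 < d)%N -> (d %| h)%N -> #|[set x : F | x ^+ (2 ^ d) == x]| = (2 ^ d)%N.
Proof.
move=> d0 dh; have := dvdp_frob_fix dh; rewrite -cardF => /card_roots_of_split.
rewrite size_frob_fix //=; apply: etrans; apply: eq_card => x.
by rewrite !inE /root !hornerE subr_eq0.
Qed.

Lemma card_frob_fix_le d (A : {set F}) : (0 < d)%N ->
  {in A, forall x, x ^+ (2 ^ d) = x} -> (#|A| <= 2 ^ d)%N.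
Proof.
move=> d0 HA; rewrite -ltnS -size_frob_fix //; apply: card_roots_lt.
  by rewrite -size_poly_eq0 size_frob_fix.
by move=> x /HA xd; rewrite /root !hornerE xd subrr.
Qed.

(** The trace as a bit: [Tr] only takes the values 0 and 1, so trace conditions become Boolean
    identities with [(+)] as addition. *)
Definition tr (x : F) : bool := Tr x == 1.

Lemma logF : logn 2 #|F| = h.
Proof. by rewrite cardF pfactorK. Qed.

Lemma TrD (x y : F) : Tr (x + y) = Tr x + Tr y.
Proof. by rewrite /Tr -big_split; apply: eq_bigr => i _; rewrite frobD. Qed.

Lemma h_gt0 : (0 < h)%N.
Proof.
rewrite lt0n; apply/eqP => h0; have := card_finRing_gt1 F.
by rewrite cardF h0.
Qed.

Lemma Tr_sqr (x : F) : Tr x ^+ 2 = Tr x.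
Proof.
rewrite /Tr logF.
have -> : forall n, (\sum_(i < n) x ^+ (2 ^ i)) ^+ 2 = \sum_(i < n) x ^+ (2 ^ i.+1).
  elim=> [|n IH]; first by rewrite !big_ord0 expr0n.
  by rewrite !big_ord_recr /= sqrfD IH -exprM expnSr.
case: h frob_fix h_gt0 => // n fx _.
by rewrite big_ord_recr big_ord_recl /= fx addrC.
Qed.

Lemma Tr_tr (x : F) : Tr x = (tr x)%:R.
Proof.
have /eqP := Tr_sqr x; rewrite -subr_eq0 -{2}[Tr x]mul1r expr2 -mulrBl mulf_eq0.
rewrite subr_eq0 /tr; case: eqVneq => //= _ /eqP ->; exact.
Qed.

Lemma trD (x y : F) : tr (x + y) = tr x (+) tr y.
Proof.
rewrite {1}/tr TrD !Tr_tr; case: (tr x); case: (tr y); rewrite /= ?addff ?addr0 ?add0r ?eqxx //.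
all: by rewrite eq_sym oner_eq0.
Qed.

Lemma Tr0E (x : F) : (Tr x == 0) = ~~ tr x.
Proof. by rewrite Tr_tr; case: (tr x); rewrite ?oner_eq0 ?eqxx. Qed.

Lemma tr0 : tr 0 = false.
Proof. by have := trD 0 0; rewrite addr0; case: (tr 0). Qed.

(** [Tr] is given by a polynomial of degree at most [2 ^ (h - 1)] whose coefficient at X is 1, so it
    cannot vanish on all [2 ^ h] elements. *)
Lemma tr_nontrivial : exists x, tr x.
Proof.
apply/existsP; apply: contraTT isT; rewrite negb_exists => /forallP Tr0.
pose p : {poly F} := \sum_(i < h) 'X^(2 ^ i).
have sz : forall n, (size (\sum_(i < n) 'X^(2 ^ i) : {poly F})%R <= (2 ^ n.-1).+1)%N.
  elim=> [|n IH]; first by rewrite big_ord0 size_poly0.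
  rewrite big_ord_recr /= (leq_trans (size_polyD _ _)) // geq_max size_polyXn leqnn andbT.
  by apply: leq_trans IH _; rewrite ltnS leq_exp2l // leq_pred.
have p0 : p != 0.
  apply/eqP => /(congr1 (fun q : {poly F} => q`_1)); rewrite coef0 coef_sum.
  case: h h_gt0 => // n _; rewrite big_ord_recl big1 ?coefXn ?addr0 ?eqxx.
    by move/eqP; rewrite oner_eq0.
  move=> i _; rewrite coefXn /=; case: eqP => // /esym/eqP.
  by rewrite -(expn0 2) eqn_exp2l.
have: (#|[set: F]| < size p)%N.
  apply: card_roots_lt => // x _; rewrite /root horner_sum.
  under eq_bigr do rewrite hornerXn.
  by have := Tr0 x; rewrite -Tr0E /Tr logF.
rewrite cardsT cardF ltnNge; case/negP; apply: leq_trans (sz h) _.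
by rewrite ltn_exp2l // prednK ?h_gt0.
Qed.

End Char2.

(** * Trace equations for independent families *)

Section Lin.
Variables (F : finFieldType) (h : nat).
Hypothesis cardF : #|F| = (2 ^ h)%N.
Let addff := addff cardF.
Let trD := trD cardF.

(** Coefficients over F_2 are kept as a list of Booleans, which can be destructed and evaluated. The
    sum stops at the end of the shorter list, whence the size conditions below. *)
Fixpoint lin (m : bitseq) (s : seq F) : F :=
  if m is b :: m' then if s is a :: s' then a *+ b + lin m' s' else 0 else 0.

Definition indep (s : seq F) :=
  forall m, size m = size s -> lin m s = 0 -> all negb m.

Definition trs (s : seq F) (x : F) : bitseq := [seq tr (a * x) | a <- s].

Lemma indep_drop2 a b s : indep (a :: b :: s) -> indep (a :: s).
Proof.
move=> I [|e m] //= [sm] H; have /= := I [:: e, false & m].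
by rewrite sm mulr0n add0r => /(_ erefl H).
Qed.

Lemma indep_behead a s : indep (a :: s) -> indep s.
Proof. by move=> I m sm H; have /= := I (false :: m); rewrite sm mulr0n add0r => ->. Qed.

Lemma indep_add2 a b s : indep (a :: b :: s) -> indep (a + b :: s).
Proof.
move=> I [|e m] //= [sm]; rewrite mulrnDl -addrA => H; have /= := I [:: e, e & m].
by rewrite sm => /(_ erefl H) /and3P[-> _ ->].
Qed.

Lemma indep_head a s : indep (a :: s) -> a != 0.
Proof.
move=> I; apply/eqP => a0; suff z : lin (nseq (size s) false) s = 0.
  have /= := I (true :: nseq (size s) false).
  by rewrite size_nseq a0 z mul0rn add0r => /(_ erefl erefl).
by elim: {I} s => //= b s ->; rewrite mulr0n addr0.
Qed.

Lemma card_fiber_add (T : finType) (A : {set T}) (p : pred T) :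
  (#|[set x in A | p x == true]| + #|[set x in A | p x == false]| = #|A|)%N.
Proof.
rewrite -(cardsID [set x | p x] A); congr addn; apply: eq_card => x; rewrite !inE //.
  by rewrite eqb_id.
by rewrite eqbF_neg andbC.
Qed.

(** Translation by [y / a], where [tr y] holds, exchanges the two fibres. *)
Lemma card_trs1 (a : F) c : a != 0 -> (#|[set x : F | tr (a * x)%R == c]| * 2 = 2 ^ h)%N.
Proof.
move=> a0; have [y yt] := tr_nontrivial cardF.
have E : #|[set x : F | tr (a * x) == true]| = #|[set x : F | tr (a * x) == false]|.
  rewrite -(card_imset _ (addrI (y / a))); apply: eq_card => x; rewrite inE.
  apply/imsetP/idP => [[z]|H].
    by rewrite inE => /eqP H ->; rewrite mulrDr trD H mulrC divfK // yt.
  exists (y / a + x); rewrite ?addrA ?addff ?add0r // inE mulrDr trD mulrC divfK // yt.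
  by rewrite (eqP H).
have := card_fiber_add [set: F] (fun x => tr (a * x)); rewrite cardsT cardF.
have S c' : [set x in [set: F] | tr (a * x) == c'] = [set x | tr (a * x) == c'].
  by apply/setP => x; rewrite !inE.
rewrite !S E addnn => <-; case: c; rewrite ?E -muln2 //.
Qed.

(** Induction on the length. For leading vectors [a], [b] let [N e f] count the solutions with bits
    [e], [f] on them. The induction hypothesis for [a :: s], [b :: s] and [a + b :: s] makes the
    sums of two of the four numbers [N e f] equal to a common value, which forces all four to be
    half of it. *)
Lemma card_trs s c : indep s -> size c = size s ->
  (#|[set x | trs s x == c]| * 2 ^ size s = 2 ^ h)%N.
Proof.
elim: {s}(size s) {-2}s (leqnn (size s)) c => [|n IH] [|a [|b s]] // ss [|c [|d c']] // I sc.
all: try by rewrite /= expn0 muln1 -cardF -cardsT; congr #|pred_of_set _|; apply/setP => x;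
  rewrite !inE.
  rewrite -(card_trs1 c (indep_head I)) /= expn1; congr (_ * _)%N.
  by apply: eq_card => x; rewrite !inE /trs /= eqseq_cons andbT.
have {}sc : size c' = size s by case: sc.
have Ha e : (#|[set x | trs (a :: s) x == e :: c']| * 2 ^ (size s).+1 = 2 ^ h)%N.
  by apply: IH => //=; [exact: indep_drop2 I | rewrite sc].
have Hb e : (#|[set x | trs (b :: s) x == e :: c']| * 2 ^ (size s).+1 = 2 ^ h)%N.
  by apply: IH => //=; [exact: indep_behead I | rewrite sc].
have Hab e : (#|[set x | trs ((a + b)%R :: s) x == e :: c']| * 2 ^ (size s).+1 = 2 ^ h)%N.
  by apply: IH => //=; [exact: indep_add2 I | rewrite sc].
pose N e f := #|[set x | trs [:: a, b & s] x == [:: e, f & c']]|.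
have Ea e : (N e true + N e false = #|[set x | trs (a :: s) x == e :: c']|)%N.
  rewrite -(card_fiber_add _ (fun x => tr (b * x))) /N; congr addn; apply: eq_card => x;
  by rewrite !inE /trs /= !eqseq_cons andbA andbAC.
have Eb e : (N true e + N false e = #|[set x | trs (b :: s) x == e :: c']|)%N.
  rewrite -(card_fiber_add _ (fun x => tr (a * x))) /N; congr addn; apply: eq_card => x;
  by rewrite !inE /trs /= !eqseq_cons andbC.
have Eab : (N true true + N false false = #|[set x | trs ((a + b)%R :: s) x == false :: c']|)%N.
  rewrite -(card_fiber_add _ (fun x => tr (a * x))) /N; congr addn; apply: eq_card => x;
  rewrite !inE /trs /= !eqseq_cons mulrDl trD; case: (tr (a * x)); case: (tr (b * x));
    rewrite ?andbF ?andbT //.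
rewrite -/(N c d) /= expnS.
move: (Ea true) (Ea false) (Eb true) (Eb false) Eab (Ha true) (Ha false) (Hb true) (Hb false)
  (Hab false).
rewrite expnS; move: (2 ^ size s)%N (2 ^ h)%N => P Q.
by case: c; case: d; nia.
Qed.

Lemma trs_surj s c : indep s -> size c = size s -> exists x, trs s x = c.
Proof.
move=> I /(card_trs I) H.
have /card_gt0P[x] : (0 < #|[set x | trs s x == c]|)%N.
  by rewrite lt0n; apply/eqP => E; move: H; rewrite E mul0n => /esym/eqP; rewrite expn_eq0.
by rewrite inE => /eqP; exists x.
Qed.

End Lin.

Lemma F2_natb (x : 'F_2) : x = (x != 0)%:R.
Proof. by apply/val_inj; case: x => [[|[|]]]. Qed.

Lemma F2_nat (x : 'F_2) : (x : nat) = (x != 0).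
Proof. by case: x => [[|[|]]]. Qed.

Lemma natb_F2 (b : bool) : (b%:R != 0 :> 'F_2) = b.
Proof. by case: b. Qed.

Lemma natb_F2_nat (b : bool) : (b%:R : 'F_2) = b :> nat.
Proof. by case: b. Qed.

(** * Spans over F_2 with Boolean coordinates *)

Section Span.
Variables (F : finFieldType) (h : nat).
Hypothesis cardF : #|F| = (2 ^ h)%N.
Let addff := addff cardF.
Let trD := trD cardF.
Let tr0 := tr0 cardF.
Implicit Types (a b c x : F) (s t : seq F) (m : bitseq).

(** The span as an image of the coordinate vectors, which gives cardinalities at once;
    [add_span_spanset] identifies it with the generated subgroup. *)
Definition spanset s : {set F} := [set lin m s | m : (size s).-tuple bool].

Lemma spansetP s x : reflect (exists2 m, size m = size s & x = lin m s) (x \in spanset s).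
Proof.
apply: (iffP imsetP) => [[m _ ->]|[m sm ->]]; first by exists m; rewrite ?size_tuple.
by have sz : size m == size s by [apply/eqP]; exists (Tuple sz).
Qed.

Lemma mulrb_add a (b b' : bool) : a *+ (b (+) b') = a *+ b + a *+ b'.
Proof. by case: b; case: b'; rewrite ?addr0 ?add0r ?mulr1n ?addff. Qed.

Fixpoint bxor m m' := match m, m' with
  b :: m, b' :: m' => (b (+) b') :: bxor m m' | _, _ => [::] end.

Lemma size_bxor m m' : size m = size m' -> size (bxor m m') = size m.
Proof. by elim: m m' => [|b m IH] [|b' m'] //= [/IH ->]. Qed.

Lemma lin_bxor s m m' : size m = size s -> size m' = size s ->
  lin (bxor m m') s = lin m s + lin m' s.
Proof.
elim: s m m' => [|a s IH] [|b m] [|b' m'] //=; try by rewrite addr0.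
by move=> [sm] [sm']; rewrite IH // mulrb_add addrACA.
Qed.

Lemma lin_nseq0 s n : lin (nseq n false) s = 0.
Proof. by elim: s n => [|a s IH] [|n] //=; rewrite IH mulr0n addr0. Qed.

Lemma lin_inj s m m' : indep s -> size m = size s -> size m' = size s ->
  lin m s = lin m' s -> m = m'.
Proof.
move=> I sm sm' /eqP; rewrite (eqf2 cardF) -lin_bxor // => /eqP /I.
rewrite size_bxor ?sm // => /(_ erefl); rewrite -{}sm' in sm *; clear I.
elim: m m' sm => [|b m IH] [|b' m'] //= [/IH{}IH] /andP[e /IH ->].
by move: e; case: b; case: b'.
Qed.

Lemma card_spanset s : indep s -> #|spanset s| = (2 ^ size s)%N.
Proof.
move=> I; rewrite card_imset ?card_tuple ?card_bool // => m m' /(lin_inj I).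
by rewrite !size_tuple => /(_ erefl erefl)/val_inj.
Qed.

(** There are only [2 ^ size s] coefficient vectors, so a span of that size makes the coordinate map
    injective. *)
Lemma indep_card s : (2 ^ size s <= #|spanset s|)%N -> indep s.
Proof.
move=> le m /eqP sm H.
have inj : {in predT &, injective (fun m' : (size s).-tuple bool => lin m' s)}.
  apply/imset_injP; rewrite eqn_leq leq_imset_card cardT -cardE.
  by rewrite card_tuple card_bool; exact: le.
have := inj (Tuple sm) (nseq_tuple _ false).
rewrite !inE /= lin_nseq0 => /(_ isT isT H) /(congr1 val) /= ->.
by rewrite all_nseq orbT.
Qed.

Lemma spanset0 s : 0 \in spanset s.
Proof. by apply/spansetP; exists (nseq (size s) false); rewrite ?size_nseq ?lin_nseq0. Qed.

Lemma spansetD s x y : x \in spanset s -> y \in spanset s -> x + y \in spanset s.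
Proof.
move=> /spansetP[m sm ->] /spansetP[m' sm' ->]; apply/spansetP.
by exists (bxor m m'); rewrite ?lin_bxor ?size_bxor ?sm.
Qed.

Lemma spanset_group s : group_set (spanset s).
Proof. by apply/group_setP; split; [exact: spanset0 | exact: spansetD]. Qed.

Lemma spanset_mem s x : x \in s -> x \in spanset s.
Proof.
elim: s => // a s IH; rewrite inE => /orP[/eqP ->|/IH /spansetP[m sm ->]]; apply/spansetP.
  by exists (true :: nseq (size s) false) => /=; rewrite ?size_nseq // lin_nseq0 addr0.
by exists (false :: m) => /=; rewrite ?sm // mulr0n add0r.
Qed.

Lemma lin_closed (G : {set F}) s m : 0 \in G -> {in G &, forall x y, x + y \in G} ->
  {subset s <= G} -> lin m s \in G.
Proof.
move=> G0 GD; elim: s m => [|a s IH] [|b m] //= sG.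
apply: GD; last by apply: IH => x xs; apply: sG; rewrite inE xs orbT.
by case: b; rewrite ?mulr0n // mulr1n sG // mem_head.
Qed.

Lemma spanset_sub s t : {subset s <= spanset t} -> spanset s \subset spanset t.
Proof.
move=> st; apply/subsetP => _ /spansetP[m _ ->]; apply: lin_closed => //.
  exact: spanset0.
exact: spansetD.
Qed.

Lemma add_span_spanset s : add_span [set x in s] = spanset s.
Proof.
apply/eqP; rewrite eqEsubset; apply/andP; split.
  rewrite /add_span (gen_subG _ (Group (spanset_group s))).
  by apply/subsetP => x; rewrite inE => /spanset_mem.
apply/subsetP => _ /spansetP[m _ ->]; apply: lin_closed.
- exact: (@group1 F <<[set x in s]>>%G).
- by move=> x y; exact: (@groupM F <<[set x in s]>>%G).
- by move=> x xs; apply: mem_gen; rewrite inE.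
Qed.

Lemma span4E a1 a2 a3 a4 : span4 a1 a2 a3 a4 = spanset [:: a1; a2; a3; a4].
Proof. by rewrite -add_span_spanset; congr add_span; apply/setP => x; rewrite !inE !orbA. Qed.

Lemma F2_indep4 a1 a2 a3 a4 :
  F2_independent [tuple a1; a2; a3; a4] <-> indep [:: a1; a2; a3; a4].
Proof.
split=> [I m sm H|I l].
  have := I (fun i => (nth false m i)%:R).
  rewrite !big_ord_recl big_ord0 !natb_F2_nat /tnth /=.
  case: m sm H => [|b1 [|b2 [|b3 [|b4 []]]]] //= _ -> /(_ erefl) H.
  move: (H ord0) (H (inord 1)) (H (inord 2)) (H (inord 3)); rewrite !inordK //=.
  by case: b1 b2 b3 b4 {H} => [] [] [] [].
rewrite !big_ord_recl big_ord0 !F2_nat /tnth /= => H.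
have /= := I [:: _; _; _; _] erefl H; rewrite !negbK andbT => /and4P[/eqP e1 /eqP e2 /eqP e3 /eqP
  e4].
case=> [[|[|[|[|]]]] //= i4]; [rewrite -e1|rewrite -e2|rewrite -e3|rewrite -e4]; congr l;
  exact: val_inj.
Qed.

Lemma spanset_mulr c s : spanset [seq a * c | a <- s] = [set x * c | x in spanset s].
Proof.
have lin_mul m : lin m [seq a * c | a <- s] = lin m s * c.
  by elim: s m => [|a s IH] [|b m]; rewrite /= ?mul0r // IH mulrDl mulrnAl.
apply/setP => x; apply/spansetP/imsetP => [[m sm ->]|[_ /spansetP[m sm ->] ->]].
  exists (lin m s); rewrite ?lin_mul //; apply/spansetP.
  by exists m; rewrite // sm size_map.
by exists m; rewrite ?size_map.
Qed.

Lemma indep_mulr c s : c != 0 -> indep s -> indep [seq a * c | a <- s].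
Proof.
move=> c0 I; apply: indep_card; rewrite spanset_mulr size_map -card_spanset //.
by rewrite [#|[set _ * c | _ in _]|]card_imset //; exact: mulIf.
Qed.

Lemma trs0P s x : reflect {in spanset s, forall y, tr (y * x) = false} (~~ has id (trs s x)).
Proof.
apply: (iffP hasPn) => [H _ /spansetP[m _ ->]|H _ /mapP[a sa ->]].
  elim: s m H => [|a s IH] [|b m] H /=; rewrite ?mul0r //.
  rewrite mulrDl trD IH ?addbF => [|d ds]; last by apply: H; rewrite inE ds orbT.
  by case: b; rewrite ?mul0r //; apply: negbTE; apply: H; rewrite inE eqxx.
by rewrite H // spanset_mem.
Qed.

Lemma eq_spanset s t : indep t -> size s = size t ->
  {subset t <= spanset s} -> spanset s = spanset t.
Proof.
move=> I st ts; apply/esym/eqP; rewrite eqEcard spanset_sub //= [#|spanset t|]card_spanset //.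
by rewrite -st (leq_trans (leq_imset_card _ _)) // card_tuple card_bool.
Qed.

(** By linearity, whether some trace bit is set depends on the span only. This allows the families
    a_i^2, a_i a_4 and the basis used at infinity to be exchanged. *)
Lemma trs0_span s t x : indep t -> size s = size t -> {subset t <= spanset s} ->
  has id (trs s x) = has id (trs t x).
Proof.
move=> I st ts; apply: negb_inj; apply/trs0P/trs0P; rewrite (eq_spanset I st ts) //.
Qed.

End Span.

(* The values of Tr (a_i z), i = 1, ..., 4, at an affine point (1, y, z) of the set. *)
Definition fvals (l : bitseq) : bitseq := match l with
  | [:: x; y; z; _] =>
      [:: x (+) y (+) z (+) (y && z); y (+) z (+) (x && z); z (+) (x && y); false]
  | _ => [::] end.

(** * Coordinates of the constructed sets *)

Section KMset.
Variables (F : finFieldType) (h : nat).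
Hypothesis cardF : #|F| = (2 ^ h)%N.
Let trD := trD cardF.
Let tr0 := tr0 cardF.
Implicit Types (a b c x : F) (s t : seq F) (m : bitseq).

Definition affpt (p : F * F) := point (row3 1 p.1 p.2).
Definition infpt x := point (row3 0 1 x).

Lemma row3E x y z i : row3 x y z 0 i = tnth [tuple x; y; z] i.
Proof. by rewrite mxE. Qed.

Lemma row3_mul x y z (u : 'cV[F]_3) :
  (row3 x y z *m u == 0) = (x * u 0 0 + y * u 1 0 + z * u 2%:R 0 == 0).
Proof.
have -> : row3 x y z *m u = (x * u 0 0 + y * u 1 0 + z * u 2%:R 0)%:M.
  apply/rowP => i; rewrite !mxE ord1 eqxx mulr1n !big_ord_recl big_ord0 !row3E /tnth /= addr0 addrA.
  by congr (_ * u _ _ + _ * u _ _ + _ * u _ _); apply/val_inj.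
apply/eqP/eqP => [/rowP/(_ 0)|->]; last by rewrite raddf0.
by rewrite !mxE eqxx mulr1n.
Qed.

Lemma row3_inj x y z x' y' z' : row3 x y z = row3 x' y' z' -> [/\ x = x', y = y' & z = z'].
Proof.
move=> E; split.
- by move/rowP: E => /(_ ord0); rewrite !row3E.
- by move/rowP: E => /(_ (inord 1)); rewrite !row3E /tnth !inordK.
- by move/rowP: E => /(_ (inord 2)); rewrite !row3E /tnth !inordK.
Qed.

Lemma scale_row3 k x y z : k *: row3 x y z = row3 (k * x) (k * y) (k * z).
Proof.
by apply/rowP => i; rewrite mxE !row3E /tnth; case: i => [[|[|[|]]] ?].
Qed.

Lemma mem_point (v : 'rV[F]_3) : v \in point v.
Proof. by apply/imsetP; exists 1; rewrite ?scale1r. Qed.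

Lemma point_scale k (v : 'rV[F]_3) : k != 0 -> point (k *: v) = point v.
Proof.
move=> k0; apply/setP => w; apply/imsetP/imsetP => [] [c _ ->].
  by exists (c * k); rewrite ?scalerA.
by exists (c / k); rewrite ?scalerA ?divfK.
Qed.

Lemma affpt_inj : injective affpt.
Proof.
move=> [y z] [y' z'] E; have := mem_point (row3 1 y z); rewrite -/(affpt (y, z)) E.
case/imsetP=> k _; rewrite scale_row3 mulr1 => /row3_inj[<-].
by rewrite !mul1r => -> ->.
Qed.

Lemma infpt_inj : injective infpt.
Proof.
move=> x x' E; have := mem_point (row3 0 1 x); rewrite -/(infpt x) E.
case/imsetP=> k _; rewrite scale_row3 mulr1 => /row3_inj[_ <-].
by rewrite !mul1r => ->.
Qed.

Lemma affpt_infpt p x : affpt p <> infpt x.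
Proof.
move=> E; have := mem_point (row3 1 p.1 p.2); rewrite -/(affpt p) E.
case/imsetP=> k _; rewrite scale_row3 mulr0 => /row3_inj[/eqP].
by rewrite oner_eq0.
Qed.

Lemma affpt_PG2 p : affpt p \in PG2 F.
Proof.
apply/imsetP; exists (row3 1 p.1 p.2); rewrite ?inE //; apply/eqP=> /rowP/(_ ord0).
by rewrite row3E mxE => /eqP; rewrite oner_eq0.
Qed.

Lemma infpt_PG2 x : infpt x \in PG2 F.
Proof.
apply/imsetP; exists (row3 0 1 x); rewrite ?inE //; apply/eqP=> /rowP/(_ (inord 1)).
by rewrite row3E mxE /tnth inordK //= => /eqP; rewrite oner_eq0.
Qed.

Lemma point_line (v : 'rV[F]_3) (u : 'cV[F]_3) : point v \in PG2 F ->
  (point v \in line u) = (v *m u == 0).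
Proof.
move=> vP; rewrite inE vP /=; apply/subsetP/idP => [H|/eqP H w].
  by have := H v (mem_point v); rewrite inE.
by case/imsetP=> k _ ->; rewrite inE -scalemxAl H scaler0.
Qed.

(** By duality of the b_j with the a_i, the coset of S in the construction is the set of z with
    prescribed bits Tr (a_i z). In this form the b_j no longer appear. *)
Definition aff_coords s : {set F * F} :=
  [set p | [exists l : 4.-tuple bool, (p.1 == lin l s) && (trs s p.2 == fvals l)]].

Definition inf_basis a1 a2 a3 a4 a :=
  [:: a1 * (a1 + a4); a2 * (a2 + a4); a3 * (a3 + a4); a4 * a].

Definition inf_coords a1 a2 a3 a4 a : {set F} :=
  [set x | trs (inf_basis a1 a2 a3 a4 a) x == [:: false; false; false; true]].

Lemma aff_coordsP s p : reflect (exists l1 l2 l3 l4, p.1 = lin [:: l1; l2; l3; l4] s /\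
   trs s p.2 = fvals [:: l1; l2; l3; l4]) (p \in aff_coords s).
Proof.
rewrite inE; apply: (iffP existsP) => [[l /andP[/eqP -> /eqP ->]]|[l1 [l2 [l3 [l4 [-> ->]]]]]].
  case: l => [[|l1 [|l2 [|l3 [|l4 []]]]] //= sl].
  by exists l1, l2, l3, l4.
by exists [tuple l1; l2; l3; l4]; rewrite !eqxx.
Qed.

Lemma f1E (x y z : 'F_2) : (f1 x y z != 0) = (x != 0) (+) (y != 0) (+) (z != 0) (+) ((y != 0) &&
  (z != 0)).
Proof. by rewrite (F2_natb x) (F2_natb y) (F2_natb z) !natb_F2;
  case: (x != 0) (y != 0) (z != 0) => [] [] []. Qed.
Lemma f2E (x y z : 'F_2) : (f2 x y z != 0) = (y != 0) (+) (z != 0) (+) ((x != 0) && (z != 0)).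
Proof. by rewrite (F2_natb x) (F2_natb y) (F2_natb z) !natb_F2;
  case: (x != 0) (y != 0) (z != 0) => [] [] []. Qed.
Lemma f3E (x y z : 'F_2) : (f3 x y z != 0) = (z != 0) (+) ((x != 0) && (y != 0)).
Proof. by rewrite (F2_natb x) (F2_natb y) (F2_natb z) !natb_F2;
  case: (x != 0) (y != 0) (z != 0) => [] [] []. Qed.

Lemma trs_beta a1 a2 a3 a4 b1 b2 b3 (e1 e2 e3 : bool) x :
  beta_choice a1 a2 a3 a4 b1 b2 b3 ->
  (x \in setS a1 a2 a3 a4) =
  (trs [:: a1; a2; a3; a4] (b1 *+ e1 + b2 *+ e2 + b3 *+ e3 + x) == [:: e1; e2; e3; false]).
Proof.
case=> _ _ _ B.
have T i j : tr (tnth [tuple a1; a2; a3; a4] i * tnth [tuple b1; b2; b3] j) = (i == j :> nat).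
  by rewrite /tr B; case: (i == j :> nat); rewrite ?eqxx // eq_sym oner_eq0.
have X a b (e : bool) : tr (a * (b *+ e)) = tr (a * b) && e.
  by case: e; rewrite ?andbT // mulr0n mulr0 tr0 andbF.
rewrite inE /= !mulrDr !trD !X !(Tr0E cardF) !eqseq_cons /=.
move: (fun i => T i ord0) (fun i => T i (inord 1)) (fun i => T i (inord 2)).
rewrite /tnth !inordK //= => T1 T2 T3.
move: (T1 ord0) (T1 (inord 1)) (T1 (inord 2)) (T1 (inord 3)).
move: (T2 ord0) (T2 (inord 1)) (T2 (inord 2)) (T2 (inord 3)).
move: (T3 ord0) (T3 (inord 1)) (T3 (inord 2)) (T3 (inord 3)).
rewrite !inordK //= => -> -> -> -> -> -> -> -> -> -> -> -> /=.
by case: e1 e2 e3 (tr (a1 * x)) (tr (a2 * x)) (tr (a3 * x)) (tr (a4 * x)) => [] [] [] [] [] [] [].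
Qed.

Lemma KM_setE a1 a2 a3 a4 a b1 b2 b3 : beta_choice a1 a2 a3 a4 b1 b2 b3 ->
  KM_set a1 a2 a3 a4 a b1 b2 b3 =
  affpt @: aff_coords [:: a1; a2; a3; a4] :|: infpt @: inf_coords a1 a2 a3 a4 a.
Proof.
move=> B; rewrite /KM_set setUC; congr (_ :|: _); last first.
  apply/setP => P; apply/imsetP/imsetP => [] [x H ->]; exists x => //; move: H;
  by rewrite !inE /= !(Tr0E cardF) !eqseq_cons !eqbF_neg eqb_id andbT.
apply/setP => P; apply/bigcupP/imsetP => [[l1 _ /bigcupP[l2 _ /bigcupP[l3 _ /bigcupP[l4 _
  /imsetP[x xS ->]]]]]|].
  exists (a1 *+ l1 + a2 *+ l2 + a3 *+ l3 + a4 *+ l4,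
          b1 *+ f1 l1 l2 l3 + b2 *+ f2 l1 l2 l3 + b3 *+ f3 l1 l2 l3 + x) => //.
  apply/aff_coordsP; exists (l1 != 0), (l2 != 0), (l3 != 0), (l4 != 0); split.
    by rewrite /= !F2_nat addr0 !addrA.
  by apply/eqP; rewrite /fvals -f1E -f2E -f3E !F2_nat -(trs_beta _ _ _ _ B).
case=> [[y z] /aff_coordsP[l1 [l2 [l3 [l4 [/= -> E]]]]] ->].
pose e1 := f1 l1%:R l2%:R l3%:R; pose e2 := f2 l1%:R l2%:R l3%:R; pose e3 := f3 l1%:R l2%:R l3%:R.
exists l1%:R => //; apply/bigcupP; exists l2%:R => //; apply/bigcupP; exists l3%:R => //.
apply/bigcupP; exists l4%:R => //; apply/imsetP.
set w := b1 *+ (e1 != 0) + b2 *+ (e2 != 0) + b3 *+ (e3 != 0).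
(* In characteristic 2, adding [w] removes the combination of the b_j from [z] and leaves the
   element of S. *)
exists (w + z).
  rewrite (trs_beta (e1 != 0) (e2 != 0) (e3 != 0) _ B) addrA (addff cardF) add0r.
  by rewrite [trs _ _]E f1E f2E f3E !natb_F2.
by rewrite !natb_F2_nat !F2_nat -/w [w + _]addrA (addff cardF) add0r /affpt /= addr0 !addrA.
Qed.

End KMset.

(** * Intersections with lines *)

(** A quantifier over bits that evaluates, used with [bits] to reduce finite checks to
    [vm_compute]. *)
Definition allb (P : bool -> bool) := P true && P false.
Lemma allbP P : allb P -> forall b, P b.
Proof. by case/andP=> Pt Pf []. Qed.

Fixpoint bits n : seq bitseq :=
  if n is n'.+1 then [seq b :: l | b <- [:: true; false], l <- bits n'] else [:: [::]].

Lemma mem_bits n l : (l \in bits n) = (size l == n).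
Proof.
elim: n l => [|n IH] [|b l] //.
  by apply/negbTE/negP => /allpairsP[[? ?] []].
rewrite eqSS -IH; apply/allpairsP/idP => [[[c l'] /= [_ l'n [_ ->]]]//|ln].
by exists (b, l); case: b.
Qed.

Lemma bits_uniq n : uniq (bits n).
Proof. by elim: n => // n IH; apply: allpairs_uniq => // -[? ?] [? ?] _ _ [-> ->]. Qed.

Arguments bits : simpl never.

Lemma sum_tuple_bits n (G : bitseq -> nat) :
  (\sum_(l : n.-tuple bool) G l = \sum_(l <- bits n) G l)%N.
Proof.
rewrite -(big_map val xpredT G); apply: perm_big; apply: uniq_perm.
- by rewrite map_inj_uniq ?index_enum_uniq //; exact: val_inj.
- exact: bits_uniq.
move=> l; rewrite mem_bits; apply/mapP/idP => [[t _ ->]|sl]; first by rewrite size_tuple.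
by exists (Tuple sl); rewrite // mem_index_enum.
Qed.

(* [Mij] stands for Tr (m a_i a_j) and [bi] for Tr (b a_i). *)
Definition on_line (M11 M22 M33 M44 M12 M13 M23 M14 M24 M34 b1 b2 b3 b4 : bool)
    (l : bitseq) : bool :=
  if l is [:: x; y; z; w] then
    [:: b1 (+) (M11 && x) (+) (M12 && y) (+) (M13 && z) (+) (M14 && w);
        b2 (+) (M12 && x) (+) (M22 && y) (+) (M23 && z) (+) (M24 && w);
        b3 (+) (M13 && x) (+) (M23 && y) (+) (M33 && z) (+) (M34 && w);
        b4 (+) (M14 && x) (+) (M24 && y) (+) (M34 && z) (+) (M44 && w)] == fvals l
  else false.

(* The hypothesis expresses that the a_i^2 and the a_i a_4 span the same space; the bracketed
   condition says that the point (0, 1, m) of the line is in the set. *)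
Lemma on_line_count M11 M22 M33 M44 M12 M13 M23 M14 M24 M34 b1 b2 b3 b4 :
  [|| M11, M22, M33 | M44] = [|| M14, M24, M34 | M44] ->
  (count (on_line M11 M22 M33 M44 M12 M13 M23 M14 M24 M34 b1 b2 b3 b4) (bits 4)
   + [&& M11 == M14, M22 == M24, M33 == M34 & [|| M14, M24, M34 | M44]])%N
  \in [:: 0; 2]%N.
Proof.
(* With the hypothesis turned into a Boolean implication, the claim is a closed Boolean that ranges
   over the [2 ^ 14] values of the bits. *)
move=> H; apply: (implyP _ (introT eqP H)) => {H}.
move: b4; apply/allbP; move: b3; apply/allbP; move: b2; apply/allbP; move: b1; apply/allbP.
move: M34; apply/allbP; move: M24; apply/allbP; move: M14; apply/allbP.
move: M23; apply/allbP; move: M13; apply/allbP; move: M12; apply/allbP.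
move: M44; apply/allbP; move: M33; apply/allbP; move: M22; apply/allbP; move: M11; apply/allbP.
by vm_compute.
Qed.

Section Arc.
Variables (F : finFieldType) (h : nat).
Hypotheses (cardF : #|F| = (2 ^ h)%N) (h_gt3 : (3 < h)%N).
Implicit Types (a b c x : F) (s t : seq F) (m : bitseq).

Lemma card_trs4 s m : indep s -> size s = 4 -> size m = 4 ->
  #|[set x | trs s x == m]| = (#|F| %/ 16)%N.
Proof.
move=> I s4 c4; have := card_trs cardF I (etrans c4 (esym s4)).
by rewrite s4 cardF => <-; rewrite mulnK.
Qed.

(** The points are sorted by the coordinate vector of [y], which is unique by independence. *)
Lemma card_aff_coords_cond s (Q : F -> F -> bool) : indep s -> size s = 4 ->
  #|[set p in aff_coords s | Q p.1 p.2]| =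
  (\sum_(l <- bits 4) #|[set z | (trs s z == fvals l) && Q (lin l s) z]|)%N.
Proof.
move=> I s4; rewrite -sum_tuple_bits.
have -> : [set p in aff_coords s | Q p.1 p.2] =
    [set (lin (val r.1) s, r.2) | r in [set r : 4.-tuple bool * F |
      (trs s r.2 == fvals r.1) && Q (lin r.1 s) r.2]].
  apply/setP => -[y z]; rewrite !inE /=; apply/andP/imsetP.
    by case=> /existsP[l /andP[/eqP -> H1]] H2; exists (l, z); rewrite ?inE ?H1.
  case=> [[l z']]; rewrite inE /= => /andP[H1 H2] [-> ->]; split=> //.
  by apply/existsP; exists l; rewrite eqxx.
rewrite card_imset; last first.
  move=> [l z] [l' z'] [/(lin_inj cardF I)]; rewrite !size_tuple s4 => /(_ erefl erefl).
  by move/val_inj => -> ->.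
rewrite -sum1_card (eq_bigl (fun r : 4.-tuple bool * F => (trs s r.2 == fvals r.1) && Q (lin r.1
  s) r.2)); last first.
  by move=> r; rewrite inE.
rewrite -(pair_big_dep xpredT (fun (l : 4.-tuple bool) z => (trs s z == fvals l) && Q (lin l s)
  z) (fun _ _ => 1%N)) /=.
apply: eq_bigr => l _; rewrite sum1_card; apply: eq_card => z; by rewrite inE.
Qed.

Lemma size_fv l : l \in bits 4 -> size (fvals l) = 4.
Proof. by rewrite mem_bits; case: l => [|? [|? [|? [|? []]]]]. Qed.

Lemma card_aff_coords s : indep s -> size s = 4 -> #|aff_coords s| = #|F|.
Proof.
move=> I s4; have := card_aff_coords_cond (fun _ _ => true) I s4.
have -> : [set p in aff_coords s | true] = aff_coords s by apply/setP=> p; rewrite inE andbT.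
move=> ->; rewrite (eq_big_seq (fun=> #|F| %/ 16)%N) => [|l lb].
  rewrite big_const_seq count_predT iter_addn_0.
  rewrite cardF -(subnK h_gt3) expnD mulnK //.
rewrite -(card_trs4 I s4 (size_fv lb)); apply: eq_card => z.
by rewrite !inE andbT.
Qed.

Lemma card_meet_line (P : {set F * F}) (Q : {set F}) (u : 'cV[F]_3) :
  #|(@affpt F @: P :|: @infpt F @: Q) :&: line u| =
  (#|[set p in P | (u 0 0 + p.1 * u 1 0 + p.2 * u 2%:R 0 == 0)%R]| +
   #|[set x in Q | (u 1 0 + x * u 2%:R 0 == 0)%R]|)%N.
Proof.
rewrite setIUl cardsU.
have -> : (@affpt F @: P :&: line u) :&: (@infpt F @: Q :&: line u) = set0.
  apply/setP => X; rewrite !inE; apply/negP => /andP[/andP[/imsetP[p _ ->] _] /andP[/imsetP[x _ ]]].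
  by move/affpt_infpt.
rewrite cards0 subn0; congr (_ + _)%N.
  rewrite -(card_imset _ (@affpt_inj F)); apply: eq_card => X; rewrite inE.
  apply/andP/imsetP => [[/imsetP[p pP ->]]|[p]].
    rewrite point_line ?affpt_PG2 // row3_mul mul1r => H.
    by exists p; rewrite ?inE ?pP.
  rewrite inE => /andP[pP H] ->; split; first exact: imset_f.
  by rewrite point_line ?affpt_PG2 // row3_mul mul1r.
rewrite -(card_imset _ (@infpt_inj F)); apply: eq_card => X; rewrite inE.
apply/andP/imsetP => [[/imsetP[p pP ->]]|[p]].
  rewrite point_line ?infpt_PG2 // row3_mul mul1r mul0r add0r => H.
  by exists p; rewrite ?inE ?pP.
rewrite inE => /andP[pP H] ->; split; first exact: imset_f.
by rewrite point_line ?infpt_PG2 // row3_mul mul1r mul0r add0r.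
Qed.

End Arc.

(** * Admissible tuples and the arc property *)

Section KMarc.
Variables (F : finFieldType) (h : nat).
Hypotheses (cardF : #|F| = (2 ^ h)%N) (h_gt5 : (5 < h)%N).
Let trD := trD cardF.
Let tr0 := tr0 cardF.
Let h_gt3 : (3 < h)%N. Proof. by apply: leq_trans h_gt5. Qed.

Lemma lin_sqr (s : seq F) m : lin m [seq x * x | x <- s] = lin m s * lin m s.
Proof.
elim: s m => [|x s IH] [|b m] /=; rewrite ?mul0r // IH -!expr2 (sqrfD cardF).
by case: b; rewrite // !mulr0n expr0n.
Qed.

Lemma indep_sqr (s : seq F) : indep s -> indep [seq x * x | x <- s].
Proof.
move=> I m; rewrite size_map lin_sqr => sm /eqP; rewrite mulf_eq0 orbb => /eqP.
exact: I.
Qed.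

(** The condition on squares is automatic for a4, since a4^2 / a4 = a4, and independence makes the
    elements nonzero. *)
Lemma admissibleP (a1 a2 a3 a4 : F) : admissible a1 a2 a3 a4 <->
  [/\ indep [:: a1; a2; a3; a4], a4 != 0 &
      {in [:: a1; a2; a3; a4], forall x, x ^+ 2 / a4 \in spanset [:: a1; a2; a3; a4]}].
Proof.
rewrite /admissible -(span4E cardF); split=> [[[_ _ _ a40] /F2_indep4 I [H1 H2 H3]]|[I a40 H]].
  split=> // x; rewrite !inE => /or4P[] /eqP -> //.
  by rewrite expr2 mulfK // (span4E cardF); apply: spanset_mem; rewrite !inE eqxx !orbT.
split; [split=> //|exact/F2_indep4|by split; apply: H; rewrite !inE eqxx ?orbT].
- exact: indep_head I.
- exact: indep_head (indep_behead I).
- exact: indep_head (indep_behead (indep_behead I)).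
Qed.

Section Adm.
Variables a1 a2 a3 a4 : F.
Hypothesis adm : admissible a1 a2 a3 a4.
Let s := [:: a1; a2; a3; a4].

Let Is : indep s. Proof. by case/admissibleP: adm. Qed.
Let a40 : a4 != 0. Proof. by case/admissibleP: adm. Qed.

Lemma sqr_in_span x : x \in spanset s -> x * x \in spanset [seq y * a4 | y <- s].
Proof.
move=> /spansetP[m sm ->]; rewrite -lin_sqr; apply: lin_closed.
- exact: spanset0.
- exact: (spansetD cardF).
move=> _ /mapP[y ys ->]; rewrite spanset_mulr; apply/imsetP; exists (y ^+ 2 / a4).
  by case/admissibleP: adm => _ _; apply.
by rewrite divfK // expr2.
Qed.

(** The squares a_i^2 are independent and lie in the 4-dimensional space V a4, where V is the span
    of the tuple, so they span it. This supplies the hypothesis of [on_line_count]. *)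
Lemma has_trs_sqr m : has id (trs [seq y * y | y <- s] m) = has id (trs [seq y * a4 | y <- s] m).
Proof.
symmetry; apply: (trs0_span cardF) => //; first exact: indep_sqr.
by move=> _ /mapP[y ys ->]; apply: sqr_in_span; apply: spanset_mem.
Qed.

Variable a : F.
Hypothesis ac : alpha_choice a1 a2 a3 a4 a.
Let t := inf_basis a1 a2 a3 a4 a.
Let It : indep t. Proof. by case: ac => _ /F2_indep4. Qed.

Lemma has_trs_inf_basis m : has id (trs [seq y * a4 | y <- s] m) = has id (trs t m).
Proof.
apply: (trs0_span cardF) => // x; have sa y : y \in s -> y * (y + a4) \in spanset [seq y * a4 | y
  <- s].
  move=> ys; rewrite mulrDr; apply: (spansetD cardF).
    by apply: sqr_in_span; apply: spanset_mem.
  by apply: spanset_mem; apply: (map_f (fun y => y * a4)).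
rewrite !inE => /or4P[] /eqP ->; try by apply: sa; rewrite !inE eqxx ?orbT.
rewrite spanset_mulr mulrC; apply: imset_f; case: ac; by rewrite (span4E cardF).
Qed.

(** The basis at infinity spans V a4 as well. Once its first three bits vanish, the fourth is set
    exactly when the trace form of [m] is nonzero on V a4, which eliminates [a]. *)
Lemma mem_inf_coords m : (m \in inf_coords a1 a2 a3 a4 a) =
  [&& tr (a1 * a1 * m) == tr (a1 * a4 * m), tr (a2 * a2 * m) == tr (a2 * a4 * m),
   tr (a3 * a3 * m) == tr (a3 * a4 * m) &
   [|| tr (a1 * a4 * m), tr (a2 * a4 * m), tr (a3 * a4 * m) | tr (a4 * a4 * m)]].
Proof.
have := has_trs_inf_basis m; rewrite inE /= !orbF !mulrDr !mulrDl !trD !eqseq_cons !eqbF_neg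
  eqb_id andbT.
move=> ->; case: (tr (a1 * a1 * m)); case: (tr (a1 * a4 * m)) => //=;
case: (tr (a2 * a2 * m)); case: (tr (a2 * a4 * m)) => //=;
case: (tr (a3 * a3 * m)); case: (tr (a3 * a4 * m)) => //=.
Qed.

Lemma trs_line (m b : F) l : l \in bits 4 ->
  (trs s (b + lin l s * m) == fvals l) =
  on_line (tr (a1 * a1 * m)) (tr (a2 * a2 * m)) (tr (a3 * a3 * m)) (tr (a4 * a4 * m))
    (tr (a1 * a2 * m)) (tr (a1 * a3 * m)) (tr (a2 * a3 * m))
    (tr (a1 * a4 * m)) (tr (a2 * a4 * m)) (tr (a3 * a4 * m))
    (tr (a1 * b)) (tr (a2 * b)) (tr (a3 * b)) (tr (a4 * b)) l.
Proof.
rewrite mem_bits; case: l => [|x [|y [|z [|w []]]]] // _; rewrite /on_line; congr (_ == _).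
have D c c' (e : bool) : tr (c * (c' *+ e * m)) = tr (c * c' * m) && e.
  by case: e; rewrite ?mulr1n ?andbT ?mulrA // mulr0n mulr0 mul0r tr0 andbF.
rewrite /trs /= !addr0 !mulrDl !mulrDr !trD !D (mulrC a2 a1) (mulrC a3 a1) (mulrC a3 a2).
by rewrite (mulrC a4 a1) (mulrC a4 a2) (mulrC a4 a3) !addbA.
Qed.

Lemma card_inf_coords : #|inf_coords a1 a2 a3 a4 a| = (#|F| %/ 16)%N.
Proof. by rewrite /inf_coords (card_trs4 cardF). Qed.

Variables b1 b2 b3 : F.
Hypothesis bc : beta_choice a1 a2 a3 a4 b1 b2 b3.
Let A := KM_set a1 a2 a3 a4 a b1 b2 b3.

Lemma card_KM_set : #|A| = (#|F| + #|F| %/ 16)%N.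
Proof.
rewrite /A (KM_setE cardF) // cardsU.
have -> : @affpt F @: aff_coords s :&: @infpt F @: inf_coords a1 a2 a3 a4 a = set0.
  apply/setP => X; rewrite !inE; apply/negP => /andP[/imsetP[p _ ->] /imsetP[x _ ]].
  by move/affpt_infpt.
rewrite cards0 subn0 !card_imset ?(card_aff_coords cardF) ?card_inf_coords //.
  exact: infpt_inj.
exact: affpt_inj.
Qed.

(** The four cases are the lines z = m y + b, the lines y = w through (0, 0, 1), the line x = 0, and
    the zero form, which cuts out everything. Signs disappear in characteristic 2. *)
Lemma card_KM_line (u : 'cV[F]_3) :
  #|A :&: line u| =
  if u 2%:R 0 != 0 then
    (count (fun l => trs s (u 0 0 / u 2%:R 0 + lin l s * (u 1 0 / u 2%:R 0))%R == fvals l) (bits 4)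
     + ((u 1 0 / u 2%:R 0)%R \in inf_coords a1 a2 a3 a4 a))%N
  else if u 1 0 != 0 then (if (u 0 0 / u 1 0)%R \in spanset s then #|F| %/ 16 else 0)%N
  else if u 0 0 != 0 then (#|F| %/ 16)%N else #|A|.
Proof.
rewrite /A (KM_setE cardF) // card_meet_line.
rewrite (card_aff_coords_cond cardF (fun y z => u 0 0 + y * u 1 0 + z * u 2%:R 0 == 0)) //.
case: ifPn => [u2|/negPn/eqP u2].
  congr (_ + _)%N.
    rewrite -sum1_count [RHS]big_mkcond; apply: eq_bigr => l _.
    set z0 := _ / _ + _.
    have E z : (u 0 0 + lin l s * u 1 0 + z * u 2%:R 0 == 0) = (z == z0).
      have z0E : z0 * u 2%:R 0 = u 0 0 + lin l s * u 1 0.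
        by rewrite /z0 mulrDl -(mulrA (lin l s)) !divfK.
      by rewrite -[RHS](inj_eq (mulIf u2)) z0E addrC -(eqf2 cardF).
    rewrite -[if _ then _ else _]/(nat_of_bool (trs s z0 == fvals l)).
    case: eqP => H.
      rewrite -[RHS](cards1 z0); apply: eq_card => z; rewrite !inE E.
      by case: (z =P z0) => [->|]; rewrite ?H ?eqxx ?andbF.
    apply: eq_card0 => z; rewrite !inE E; apply/negP=> /andP[/eqP H1 /eqP H2]; apply: H.
    by rewrite -H2.
  have E x : (u 1 0 + x * u 2%:R 0 == 0) = (x == u 1 0 / u 2%:R 0).
    by rewrite addrC -(eqf2 cardF) -[RHS](inj_eq (mulIf u2)) divfK.
  set w := _ / _ in E *; case: (boolP (w \in inf_coords _ _ _ _ _)) => H.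
    rewrite -[RHS](cards1 w); apply: eq_card => x; rewrite in_set E in_set1.
    by case: eqP => [->|]; rewrite ?H ?andbF.
  by apply: eq_card0 => x; rewrite in_set E; case: eqP => [->|]; rewrite ?(negbTE H) ?andbF.
rewrite u2; have [u1|u1] /= := eqVneq (u 1 0) 0.
  rewrite u1; have [u0|u0] /= := eqVneq (u 0 0) 0.
    rewrite u0 -(KM_setE cardF a bc) -/A card_KM_set; congr (_ + _)%N.
      rewrite -(card_aff_coords cardF h_gt3 Is erefl) -[aff_coords s](_ : [set p in aff_coords s
        | true] = _).
        rewrite (card_aff_coords_cond cardF (fun _ _ => true)) //; apply: eq_bigr => l _.
        by apply: eq_card => z; rewrite !inE !mulr0 !addr0 eqxx.
      by apply/setP => p; rewrite inE andbT.
    rewrite -card_inf_coords; apply: eq_card => x; by rewrite inE mulr0 addr0 eqxx andbT.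
  rewrite big1 ?add0n => [|l _].
    by rewrite -card_inf_coords; apply: eq_card => x; rewrite inE mulr0 addr0 eqxx andbT.
  by apply: eq_card0 => x; rewrite inE !mulr0 !addr0 (negbTE u0) andbF.
have -> : #|[set x in inf_coords a1 a2 a3 a4 a | (u 1 0 + x * 0 == 0)%R]| = 0%N.
  by apply: eq_card0 => x; rewrite inE mulr0 addr0 (negbTE u1) andbF.
rewrite addn0; set w := u 0 0 / u 1 0.
have E y z : (u 0 0 + y * u 1 0 + z * 0 == 0) = (y == w).
  by rewrite mulr0 addr0 -[RHS](inj_eq (mulIf u1)) divfK // addrC -(eqf2 cardF).
case: spansetP => [[m sm wE]|N]; last first.
  rewrite big1_seq // => l /andP[_]; rewrite mem_bits => /eqP sl.
  apply: eq_card0 => z; rewrite inE E; apply/negP => /andP[_ /eqP e].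
  by apply: N; exists l.
have mb : m \in bits 4 by rewrite mem_bits sm.
rewrite (bigD1_seq m) ?bits_uniq //= big1_seq ?addn0.
  rewrite -(card_trs4 cardF Is erefl (size_fv mb)); apply: eq_card => z.
  by rewrite !inE E wE eqxx andbT.
move=> l /andP[lm]; rewrite mem_bits => /eqP sl.
apply: eq_card0 => z; rewrite inE E wE; apply/negP => /andP[_ /eqP e].
by case/eqP: lm; apply: (lin_inj cardF Is) e.
Qed.

Lemma KM_set_arc : KM_arc (#|F| %/ 16) A.
Proof.
have ge4 : (#|F| %/ 16 > 2)%N.
  by rewrite cardF -(subnK h_gt3) expnD mulnK //; apply: (@leq_trans (2 ^ 2)) => //;
    rewrite leq_exp2l //; lia.
split.
- rewrite /A (KM_setE cardF) // subUset; apply/andP; split; apply/subsetP => _ /imsetP[p _ ->].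
    exact: affpt_PG2.
  exact: infpt_PG2.
- exact: card_KM_set.
- move=> u u0; rewrite card_KM_line; case: ifP => [u2|/negbFE/eqP u2].
    rewrite (eq_in_count (trs_line _ _)) mem_inf_coords.
    set n := (_ + _)%N; suff : n \in [:: 0; 2]%N.
      by rewrite !inE => /orP[] /eqP ->; rewrite ?eqxx ?orbT.
    apply: on_line_count; have := has_trs_sqr (u 1 0 / u 2%:R 0).
    by rewrite /= !orbF.
  case: ifP => [u1|/negbFE/eqP u1].
    by case: ifP => _; rewrite !inE eqxx ?orbT.
  case: ifP => [|/negbFE/eqP u00]; first by rewrite !inE eqxx ?orbT.
  case/eqP: u0; apply/colP => i; rewrite mxE.
  case: i => [[|[|[|]]] // i3]; [rewrite -[RHS]u00|rewrite -[RHS]u1|rewrite -[RHS]u2];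
    congr (u _ _); exact: val_inj.
- have uE (x y z : F) (u := (row3 x y z)^T) : [/\ u 0 0 = x, u 1 0 = y & u 2%:R 0 = z].
    by rewrite /u; split; rewrite mxE row3E.
  move=> m; rewrite !inE => /or3P[] /eqP ->.
  (* The line y = w misses the set when [w] is outside the span, and such a [w] exists because 16 <
     q. *)
  + have /subsetPn[w _ wV] : ~~ ([set: F] \subset spanset s).
      apply/negP => /subset_leq_card; rewrite cardsT (card_spanset cardF) // cardF.
      by rewrite leq_exp2l //= leqNgt (ltnW h_gt5).
    exists (row3 w 1 0)^T.
      apply/eqP => E0; case: (uE w 1 0); rewrite E0 !mxE => _ /esym/eqP.
      by rewrite oner_eq0.
    rewrite card_KM_line; case: (uE w 1 0) => -> -> ->.
    by rewrite eqxx oner_eq0 /= divr1 (negbTE wV).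
  (* On the line z = 0 the equations f_1 = f_2 = f_3 = 0 force the first three coordinates to be 0
     and leave the fourth free, hence two points; the point (0, 1, 0) is not in the set. *)
  + exists (row3 0 0 1)^T.
      apply/eqP => E0; case: (uE 0 0 1); rewrite E0 !mxE => _ _ /esym/eqP.
      by rewrite oner_eq0.
    rewrite card_KM_line; case: (uE 0 0 1) => -> -> ->; rewrite ifT ?oner_neq0 // !mul0r.
    have -> : 0 \in inf_coords a1 a2 a3 a4 a = false by rewrite mem_inf_coords !mulr0 tr0.
    rewrite addn0 (eq_count (a2 := fun l => [:: false; false; false; false] == fvals l)) //.
    by move=> l; rewrite !mulr0 addr0 /= !mulr0 tr0.
  (* The line x = 0 contains exactly the q/16 points at infinity of the set. *)
  + exists (row3 1 0 0)^T.
      apply/eqP => E0; case: (uE 1 0 0); rewrite E0 !mxE => /esym/eqP.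
      by rewrite oner_eq0.
    rewrite card_KM_line; case: (uE 1 0 0) => -> -> ->.
    by rewrite eqxx oner_eq0.
Qed.
End Adm.
End KMarc.

(** * Collineations between constructed sets *)

Section Choices.
Variables (F : finFieldType) (h : nat).
Hypothesis cardF : #|F| = (2 ^ h)%N.
Let tr0 := tr0 cardF.
Implicit Types (a b c x y z : F) (s t : seq F) (m : bitseq).

Lemma lin_rcons s m x (e : bool) : size m = size s ->
  lin (rcons m e) (rcons s x) = lin m s + x *+ e.
Proof.
elim: s m => [|y s IH] [|b m] //=; first by rewrite addr0 add0r.
by move=> [sm]; rewrite IH // addrA.
Qed.

Lemma indep_rcons s x : indep (rcons s x) <-> indep s /\ x \notin spanset s.
Proof.
split=> [I|[I xs] m].
  split=> [m sm H|].
    have := I (rcons m false); rewrite lin_rcons // mulr0n addr0 !size_rcons sm.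
    by move=> /(_ erefl H); rewrite all_rcons.
  apply/spansetP => -[m sm E]; have := I (rcons m true).
  rewrite lin_rcons // mulr1n -E (addff cardF) !size_rcons sm => /(_ erefl erefl).
  by rewrite all_rcons.
case/lastP: m => [|m e]; rewrite !size_rcons // => -[sm]; rewrite lin_rcons //.
case: e => [H|]; last by rewrite mulr0n addr0 all_rcons => /I ->.
case/negP: xs; apply/spansetP; exists m => //; symmetry; exact: (addff_eq cardF).
Qed.

(** The map x -> x (x + a4) is additive with kernel {0, a4}, hence injective on the span of a1, a2,
    a3; this makes the first three products independent. Since V a4 has 16 elements, it contains
    some a4 a outside their span of order 8. *)
Lemma alpha_exists a1 a2 a3 a4 : admissible a1 a2 a3 a4 ->
  exists a, alpha_choice a1 a2 a3 a4 a.
Proof.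
move=> /(admissibleP cardF)[I a40 H]; pose s3 := [:: a1; a2; a3].
have [I3 n4] : indep s3 /\ a4 \notin spanset s3 by apply/indep_rcons.
pose t3 := [seq x * (x + a4) | x <- s3].
have lin_t m : lin m t3 = lin m s3 * (lin m s3 + a4).
  rewrite /t3; elim: (s3) m => [|x s IH] [|b m] /=; rewrite ?mul0r // IH.
  case: b; rewrite ?mulr1n ?mulr0n ?add0r //; move: (lin m s) => w.
  have -> : (x + w) * (x + w + a4) = x * (x + a4) + w * (w + a4) + (x * w + x * w) by ring.
  by rewrite (addff cardF) addr0.
have It : indep t3.
  move=> m sm; rewrite lin_t => /eqP; rewrite mulf_eq0 => /orP[/eqP|]; first exact: I3.
  rewrite -(eqf2 cardF) => /eqP E; case/negP: n4; apply/spansetP.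
  by exists m; rewrite ?sm.
have /subsetPn[y] : ~~ ([set x * a4 | x in spanset [:: a1; a2; a3; a4]] \subset spanset t3).
  apply/negP => /subset_leq_card.
  rewrite -spanset_mulr !(card_spanset cardF) //; last exact: (indep_mulr cardF a40 I).

case/imsetP=> x xV -> xt; exists x; split; first by rewrite (span4E cardF).
by apply/F2_indep4; apply/(indep_rcons t3); rewrite mulrC.
Qed.

Lemma beta_exists a1 a2 a3 a4 : admissible a1 a2 a3 a4 ->
  exists b1 b2 b3, beta_choice a1 a2 a3 a4 b1 b2 b3.
Proof.
move=> /(admissibleP cardF)[I a40 H].
have [b1 [p1 p2 p3 p4]] := trs_surj cardF (c := [:: true; false; false; false]) I erefl.
have [b2 [q1 q2 q3 q4]] := trs_surj cardF (c := [:: false; true; false; false]) I erefl.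
have [b3 [r1 r2 r3 r4]] := trs_surj cardF (c := [:: false; false; true; false]) I erefl.
have n0 a b : tr (a * b) -> b != 0 by apply: contraTneq => ->; rewrite mulr0 tr0.
exists b1, b2, b3; split; [exact: n0 p1 | exact: n0 q2 | exact: n0 r3 |].
move=> i j; rewrite (Tr_tr cardF); congr (_%:R); rewrite /tnth.
by case: i j => [[|[|[|[|]]]] //= ?] [[|[|[|]]] //= ?];
  rewrite ?p1 ?p2 ?p3 ?p4 ?q1 ?q2 ?q3 ?q4 ?r1 ?r2 ?r3 ?r4.
Qed.

Lemma constructed_exists a1 a2 a3 a4 : admissible a1 a2 a3 a4 ->
  exists A, constructed_from a1 a2 a3 a4 A.
Proof.
move=> adm; have [a Ha] := alpha_exists adm; have [b1 [b2 [b3 Hb]]] := beta_exists adm.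
by exists (KM_set a1 a2 a3 a4 a b1 b2 b3); split=> //; exists a, b1, b2, b3.
Qed.

(** Both collineations needed have this shape: [c = 0] for the division by a4, and [k = l = 1] for
    the shear z -> z + c y. *)
Definition shear_mx (k l c : F) : 'M[F]_3 :=
  \matrix_(i < 3, j < 3) (tnth [tuple row3 1 0 0; row3 0 k c; row3 0 0 l] i) 0 j.

Lemma row3_shear k l c x y z : row3 x y z *m shear_mx k l c = row3 x (y * k) (y * c + z * l).
Proof.
apply/rowP => j; rewrite mxE !big_ord_recl big_ord0 !mxE /tnth /= addr0.
by case: j => [[|[|[|]]] //= ?]; rewrite ?mulr0 ?mulr1 ?addr0 ?add0r.
Qed.

Lemma shear_unit k l c : k != 0 -> l != 0 -> shear_mx k l c \in unitmx.
Proof.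
move=> k0 l0; rewrite unitmxE -det_tr det_trig.
  rewrite !big_ord_recl big_ord0 !mxE /tnth /= mul1r mulr1 unitfE.
  by rewrite mulf_neq0.
apply/is_trig_mxP => i j; rewrite !mxE /tnth.
case: i j => [[|[|[|]]] //= ?] [[|[|[|]]] //= ?]; by rewrite mxE.
Qed.

Lemma collineation_point (M : 'M[F]_3) v : collineation idfun M (point v) = point (v *m M).
Proof.
apply/setP => w; apply/imsetP/imsetP => [[_ /imsetP[k _ ->] ->]|[k _ ->]].
  by exists k; rewrite ?map_mx_id // scalemxAl.
by exists (k *: v); rewrite ?map_mx_id ?scalemxAl //; apply: imset_f.
Qed.

(** The collineation is injective on the points, so equal cardinalities reduce each equality of sets
    to one inclusion. *)
Lemma shear_equiv (P P' : {set F * F}) (Q Q' : {set F}) k l c : k != 0 -> l != 0 ->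
  #|P'| = #|P| -> #|Q'| = #|Q| ->
  (forall y z, (y, z) \in P -> (y * k, y * c + z * l) \in P') ->
  (forall x, x \in Q -> (c + x * l) / k \in Q') ->
  PGammaL_equiv (@affpt F @: P :|: @infpt F @: Q) (@affpt F @: P' :|: @infpt F @: Q').
Proof.
move=> k0 l0 cP cQ HP HQ; have U := shear_unit c k0 l0.
exists idfun, (shear_mx k l c); split=> //.
have caff p : collineation idfun (shear_mx k l c) (affpt p) = affpt (p.1 * k, p.1 * c + p.2 * l).
  by rewrite collineation_point row3_shear.
have cinf x : collineation idfun (shear_mx k l c) (infpt x) = infpt ((c + x * l) / k).
  rewrite collineation_point row3_shear !mul1r -[row3 _ _ _](_ : k *: row3 0 1 ((c + x * l) / k)
    = _).
    exact: point_scale.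
  by rewrite scale_row3 mulr0 mulr1 mulrC divfK.
rewrite imsetU; congr (_ :|: _).
  apply/esym/eqP; rewrite eqEcard; apply/andP; split.
    apply/subsetP => _ /imsetP[_ /imsetP[[y z] yz ->] ->]; rewrite caff.
    by apply: imset_f; apply: HP.
  rewrite card_imset ?cP; last exact: affpt_inj.
  rewrite -imset_comp card_imset // => p p' /=; rewrite !caff => /affpt_inj[].
  case: p p' => [y z] [y' z'] /= /(mulIf k0) -> /addrI/(mulIf l0) -> //.
apply/esym/eqP; rewrite eqEcard; apply/andP; split.
  apply/subsetP => _ /imsetP[_ /imsetP[x xQ ->] ->]; rewrite cinf.
  by apply: imset_f; apply: HQ.
rewrite card_imset ?cQ; last exact: infpt_inj.
rewrite -imset_comp card_imset // => p p' /=; rewrite !cinf => /infpt_inj.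
by move/(mulIf (invr_neq0 k0))/addrI/(mulIf l0).
Qed.

End Choices.

Lemma allb_intro (P : bool -> bool) : (forall b, P b) -> allb P.
Proof. by move=> H; rewrite /allb !H. Qed.

Lemma exbP (P : bool -> bool) : P true || P false -> exists b, P b.
Proof. by case/orP; [exists true | exists false]. Qed.

(* The row [gi1, gi2, gi3] holds the coordinates of the new basis vector b_i;
   [dij] is the value wanted for Tr (c b_i b_j). *)
Lemma twist_exists g11 g12 g13 g21 g22 g23 g31 g32 g33 :
  let row (c1 c2 c3 : bool) (x y z : bool) := (x && c1) (+) (y && c2) (+) (z && c3) in
  (forall x y z, [|| x, y | z] ->
     [|| row g11 g21 g31 x y z, row g12 g22 g32 x y z | row g13 g23 g33 x y z]) ->
  exists d12 d13 d23, forall x y z w w',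
    let l := fvals [:: row g11 g21 g31 x y z; row g12 g22 g32 x y z;
                    row g13 g23 g33 x y z; w'] in
    let e i := nth false l i in
    [:: row (e 0) (e 1) (e 2) g11 g12 g13 (+) row false d12 d13 x y z;
        row (e 0) (e 1) (e 2) g21 g22 g23 (+) row d12 false d23 x y z;
        row (e 0) (e 1) (e 2) g31 g32 g33 (+) row d13 d23 false x y z; false]
    = fvals [:: x; y; z; w].
Proof.
move=> row H; pose G := fun x y z => [|| x, y | z] ==>
     [|| row g11 g21 g31 x y z, row g12 g22 g32 x y z | row g13 g23 g33 x y z].
have {H} : allb (fun x => allb (fun y => allb (fun z => G x y z))).
  by do 3!apply: allb_intro => ?; apply/implyP; exact: H.
pose ex (P : bool -> bool) := P true || P false.
pose E d12 d13 d23 x y z :=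
    let l := fvals [:: row g11 g21 g31 x y z; row g12 g22 g32 x y z;
                    row g13 g23 g33 x y z; false] in
    let e i := nth false l i in
    [:: row (e 0) (e 1) (e 2) g11 g12 g13 (+) row false d12 d13 x y z;
        row (e 0) (e 1) (e 2) g21 g22 g23 (+) row d12 false d23 x y z;
        row (e 0) (e 1) (e 2) g31 g32 g33 (+) row d13 d23 false x y z; false]
    == fvals [:: x; y; z; false].
(* The fourth coordinates do not enter [fvals] and are set to [false]. What remains is a search for
   the three bits over the 512 matrices, with [G] expressing invertibility. *)
suff S : allb (fun x => allb (fun y => allb (fun z => G x y z))) ==>
  ex (fun d12 => ex (fun d13 => ex (fun d23 =>
    allb (fun x => allb (fun y => allb (fun z => E d12 d13 d23 x y z)))))).
  move/(implyP S) => /exbP[d12 /exbP[d13 /exbP[d23 H]]].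
  exists d12, d13, d23 => x y z w w'.
  by have /eqP := allbP (allbP (allbP H x) y) z.
rewrite {}/E {}/G {}/ex {}/row.
move: g33; apply/allbP; move: g32; apply/allbP; move: g31; apply/allbP.
move: g23; apply/allbP; move: g22; apply/allbP; move: g21; apply/allbP.
move: g13; apply/allbP; move: g12; apply/allbP; move: g11; apply/allbP.
by vm_compute.
Qed.

(** * Normalisation to a4 = 1 and change of basis *)

Section Equiv.
Variables (F : finFieldType) (h : nat).
Hypotheses (cardF : #|F| = (2 ^ h)%N) (h_gt5 : (5 < h)%N).
Let trD := trD cardF.
Let tr0 := tr0 cardF.
Let h_gt3 : (3 < h)%N. Proof. by apply: leq_trans h_gt5. Qed.
Implicit Types (a b c x y z : F) (s t : seq F) (m : bitseq).

Lemma admissible_scale a1 a2 a3 a4 : admissible a1 a2 a3 a4 ->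
  admissible (a1 / a4) (a2 / a4) (a3 / a4) 1.
Proof.
move=> /(admissibleP cardF)[I a40 H]; apply/(admissibleP cardF).
have E : [:: a1 / a4; a2 / a4; a3 / a4; 1] = [seq x / a4 | x <- [:: a1; a2; a3; a4]].
  by rewrite /= divff.
split; rewrite ?oner_neq0 // E.
  by apply: (indep_mulr cardF) => //; rewrite invr_eq0.
move=> _ /mapP[x xs ->]; rewrite spanset_mulr divr1 expr2 mulrACA -invfM.
apply/imsetP; exists (x ^+ 2 / a4); first exact: H.
by rewrite expr2 invfM mulrA.
Qed.

(** The map (y, z) -> (y / a4, a4 z) preserves each Tr (a_i z), as (a_i / a4) (a4 z) = a_i z; at
    infinity it acts as x -> a4^2 x. *)
Lemma constructed_scale a1 a2 a3 a4 A : constructed_from a1 a2 a3 a4 A ->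
  equiv_to_constructed (a1 / a4) (a2 / a4) (a3 / a4) 1 A.
Proof.
case=> adm [a [b1 [b2 [b3 [ac bc ->]]]]]; have adm' := admissible_scale adm.
have [a' ac'] := alpha_exists cardF adm'.
have [b1' [b2' [b3' bc']]] := beta_exists cardF adm'.
exists (KM_set (a1 / a4) (a2 / a4) (a3 / a4) 1 a' b1' b2' b3').
  by split=> //; exists a', b1', b2', b3'.
rewrite !(KM_setE cardF) //.
have /(admissibleP cardF)[I a40 _] := adm; have /(admissibleP cardF)[I' _ _] := adm'.
apply: (@shear_equiv F _ _ _ _ a4^-1 a4 0); rewrite ?invr_eq0 //.
- by rewrite !(card_aff_coords cardF).
- by rewrite !(card_inf_coords cardF).
- move=> y z /aff_coordsP[l1 [l2 [l3 [l4 [/= -> E]]]]]; apply/aff_coordsP; exists l1, l2, l3, l4;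
  split.
    by rewrite /= !addr0 !mulrDl !mulrnAl divff.
  have S u : tr (u / a4 * (z * a4)) = tr (u * z) by rewrite mulrACA mulVf ?mulr1.
  by rewrite /= mulr0 add0r mul1r !S (mulrC z) -[RHS]E.
move=> x; rewrite invrK add0r (mem_inf_coords cardF adm ac) (mem_inf_coords cardF adm' ac') !mulr1.
have S u v : tr (u / a4 * (v / a4) * (x * a4 * a4)) = tr (u * v * x).
  by congr tr; field.
have S1 u : tr (u / a4 * (x * a4 * a4)) = tr (u * a4 * x).
  by congr tr; field.
by rewrite !S !S1 !mul1r (_ : x * a4 * a4 = a4 * a4 * x) //; ring.
Qed.

(** With a4 = 1 the map w -> w^2 + w is additive, so the conditions on basis elements extend to the
    whole span. The points at infinity thus depend on V alone. *)
Lemma mem_inf_coords_span a1 a2 a3 a (m : F) :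
  admissible a1 a2 a3 1 -> alpha_choice a1 a2 a3 1 a ->
  let V := spanset [:: a1; a2; a3; 1] in
  (m \in inf_coords a1 a2 a3 1 a) =
  [forall w in V, tr (w * w * m) == tr (w * m)] && [exists w in V, tr (w * m)].
Proof.
move=> adm ac V; rewrite (mem_inf_coords cardF adm ac) !mulr1.
pose s := [:: a1; a2; a3; 1]; pose u := [seq x * x + x | x <- s].
have lin_u l : lin l u = lin l s * lin l s + lin l s.
  rewrite /u; elim: (s) l => [|x s' IH] [|b l] /=; rewrite ?mul0r ?addr0 // IH.
  rewrite -!expr2 (sqrfD cardF) addrACA; congr (_ + _).
  by case: b; rewrite // !mulr0n expr0n addr0.
have -> : [forall w in V, tr (w * w * m) == tr (w * m)] = ~~ has id (trs u m).
  apply/forall_inP/(trs0P cardF) => [H _ /spansetP[l sl ->]|H _ /spansetP[l sl ->]].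
    rewrite lin_u mulrDl trD; have /H/eqP -> : lin l s \in V by apply/spansetP; exists l.
    exact: addbb.
  have /H : lin l u \in spanset u by apply/spansetP; exists l.
  by rewrite lin_u mulrDl trD => /negbT; rewrite negb_add.
have -> : [exists w in V, tr (w * m)] = has id (trs s m).
  apply: negb_inj; rewrite negb_exists; apply/forallP/(trs0P cardF) => H w.
    by move=> wV; have := H w; rewrite wV => /negbTE.
  by rewrite negb_and -implybE; apply/implyP => /H ->.
rewrite /= !mulrDl !trD !mulr1 addbb !orbF !negb_or !negb_add /=.
by rewrite !andbA.
Qed.

(** Independence of the seven elements gives [c] with Tr (c v) = 0 on V and Tr (c b_i b_j) equal to
    the bits of [twist_exists]. The shear by [c] then corrects the affine part, and it preserves the
    conditions at infinity because [c] has zero trace against V, which is stable under squaring. *)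
Lemma basis_change a1 a2 a3 b1 b2 b3 A :
  admissible b1 b2 b3 1 ->
  spanset [:: a1; a2; a3; 1] = spanset [:: b1; b2; b3; 1] ->
  indep [:: b1; b2; b3; 1; b1 * b2; b1 * b3; b2 * b3] ->
  constructed_from a1 a2 a3 1 A -> equiv_to_constructed b1 b2 b3 1 A.
Proof.
move=> admb EV I7 [adma [a [p1 [p2 [p3 [aca bca ->]]]]]].
have [a' ac'] := alpha_exists cardF admb.
have [q1 [q2 [q3 bc']]] := beta_exists cardF admb.
exists (KM_set b1 b2 b3 1 a' q1 q2 q3).
  by split=> //; exists a', q1, q2, q3.
rewrite !(KM_setE cardF) //.
have /(admissibleP cardF)[I _ _] := adma; have /(admissibleP cardF)[I' _ Hb] := admb.
have memb b : b \in [:: b1; b2; b3; 1] -> exists g1 g2 g3 e, b = lin [:: g1; g2; g3; e] [:: a1;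
  a2; a3; 1].
  move=> bs; have /spansetP[m] : b \in spanset [:: a1; a2; a3; 1] by rewrite EV spanset_mem.
  by case: m => [|g1 [|g2 [|g3 [|e []]]]] // _ ->; exists g1, g2, g3, e.
have [g11 [g12 [g13 [e1 E1]]]] : exists g1 g2 g3 e, b1 = lin [:: g1; g2; g3; e] [:: a1; a2; a3; 1].
  by apply: memb; rewrite !inE eqxx.
have [g21 [g22 [g23 [e2 E2]]]] : exists g1 g2 g3 e, b2 = lin [:: g1; g2; g3; e] [:: a1; a2; a3; 1].
  by apply: memb; rewrite !inE eqxx orbT.
have [g31 [g32 [g33 [e3 E3]]]] : exists g1 g2 g3 e, b3 = lin [:: g1; g2; g3; e] [:: a1; a2; a3; 1].
  by apply: memb; rewrite !inE eqxx !orbT.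
pose row (c1 c2 c3 : bool) (x y z : bool) := (x && c1) (+) (y && c2) (+) (z && c3).
have combE (x y z w : bool) : lin [:: x; y; z; w] [:: b1; b2; b3; 1] =
    lin [:: row g11 g21 g31 x y z; row g12 g22 g32 x y z; row g13 g23 g33 x y z;
            row e1 e2 e3 x y z (+) w] [:: a1; a2; a3; 1].
  have M c (e f : bool) : c *+ e *+ f = c *+ (f && e).
    by case: f => //; rewrite mulr0n.
  rewrite {1}/lin E1 E2 E3 /= /row !(mulrb_add cardF) !mulrnDl !M !addr0; ring.
(* The matrix [g] is invertible: a combination of b1, b2, b3 without components along a1, a2, a3
   would lie in <1>. The coefficient [row e1 e2 e3 x y z] cancels its component along 1. *)
have nz (x y z : bool) : [|| x, y | z] ->
     [|| row g11 g21 g31 x y z, row g12 g22 g32 x y z | row g13 g23 g33 x y z].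
  apply: contraLR; rewrite !negb_or => /and3P[/negbTE r1 /negbTE r2 /negbTE r3].
  have := I' [:: x; y; z; row e1 e2 e3 x y z] erefl.
  rewrite combE r1 r2 r3 addbb /= !mulr0n !addr0 => /(_ erefl).
  by case/and4P => -> -> ->.
have [d12 [d13 [d23 D]]] := twist_exists nz.
have [c [c1 c2 c3 c4 c12 c13 c23]] :=
  trs_surj cardF (c := [:: false; false; false; false; d12; d13; d23]) I7 erefl.
have cV w : w \in spanset [:: b1; b2; b3; 1] -> tr (w * c) = false.
  by move: w; apply/(trs0P cardF); rewrite /= c1 c2 c3 c4.
have csq b : b \in [:: b1; b2; b3] -> tr (b * b * c) = false.
  move=> bs; apply: cV; rewrite -[b * b]divr1 -expr2; apply: Hb.
  by move: bs; rewrite !inE => /or3P[] ->; rewrite ?orbT.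
have c11 : tr (b1 * b1 * c) = false by apply: csq; rewrite !inE eqxx.
have c22 : tr (b2 * b2 * c) = false by apply: csq; rewrite !inE eqxx orbT.
have c33 : tr (b3 * b3 * c) = false by apply: csq; rewrite !inE eqxx !orbT.
apply: (@shear_equiv F _ _ _ _ 1 1 c); rewrite ?oner_neq0 //.
- by rewrite !(card_aff_coords cardF).
- by rewrite !(card_inf_coords cardF).
- move=> y z /aff_coordsP[l1 [l2 [l3 [l4 [yE zE]]]]]; rewrite !mulr1.
  have /spansetP[m] : y \in spanset [:: b1; b2; b3; 1].
    by rewrite -EV; apply/spansetP; exists [:: l1; l2; l3; l4].
  case: m => [|x1 [|x2 [|x3 [|x4 []]]]] // _ yE'.
  have := lin_inj cardF I (m := [:: l1; l2; l3;
    l4]) erefl _ (etrans (esym yE) (etrans yE' (combE _ _ _ _))).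
  move=> /(_ erefl)[L1 L2 L3 _]; apply/aff_coordsP; exists x1, x2, x3, x4; split=> //.
  (* The component [e] of [b] along 1 does not contribute, since Tr z = 0 at every affine point of a
     set with a4 = 1. *)
  have T b (g1 g2 g3 e : bool) : b = lin [:: g1; g2; g3; e] [:: a1; a2; a3; 1] ->
      tr (b * z) = row (nth false (fvals [:: l1; l2; l3; l4]) 0) (nth false (fvals [:: l1; l2;
        l3; l4]) 1)
                       (nth false (fvals [:: l1; l2; l3; l4]) 2) g1 g2 g3.
    have tz k : nth false (fvals [:: l1; l2; l3; l4]) k = nth false (trs [:: a1; a2; a3;
      1] z) k by rewrite zE.
    move=> ->; have t4 : tr (1 * z) = false by have := tz 3.
    rewrite !tz /row /= !addr0 !mulrDl !trD.
    have X (u : F) (f : bool) : tr (u *+ f * z) = f && tr (u * z).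
      by case: f; rewrite // mulr0n mul0r tr0.
    by rewrite !X t4 andbF addbF !addbA.
  have Y b : tr (b * (y * c)) = (x1 && tr (b1 * b * c)) (+) (x2 && tr (b2 * b * c)) (+) (x3 && tr
    (b3 * b * c)) (+) (x4 && tr (b * c)).
    rewrite yE' /= addr0 !mulrDl !mulrDr !trD.
    have X (u : F) (f : bool) : tr (b * (u *+ f * c)) = f && tr (u * b * c).
      by case: f; rewrite /= ?mulr0n ?mul0r ?mulr0 // mulrA (mulrC b).
    by rewrite !X mul1r !addbA.
  rewrite -(D x1 x2 x3 x4 l4) /trs /= !mulrDr !trD !Y.
  rewrite (T _ _ _ _ _ E1) (T _ _ _ _ _ E2) (T _ _ _ _ _ E3).
  rewrite (mulrC b2 b1) (mulrC b3 b1) (mulrC b3 b2) !mul1r.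
  move: c1 c2 c3 c4 c12 c13 c23; rewrite !mul1r => E1' E2' E3' E4' -> -> ->.
  have tz : tr z = false by case: zE => _ _ _; rewrite mul1r.
  rewrite !mulr1 c11 c22 c33 E1' E2' E3' E4' tz /row /= L1 L2 L3 /row !andbF ?addFb ?addbF.
  congr [:: _; _; _; _]; by rewrite addbC.
move=> x xP; rewrite mulr1 divr1; move: xP.
rewrite (mem_inf_coords_span _ adma aca) (mem_inf_coords_span _ admb ac') EV.
case/andP=> /forall_inP H1 /exists_inP[w wV H2]; apply/andP; split.
  apply/forall_inP => v vV; rewrite !mulrDr !trD (cV v) // cV; first exact: H1.
  rewrite -expr2 -[v ^+ 2]divr1 expr2.
  have := sqr_in_span cardF admb vV; rewrite spanset_mulr => /imsetP[u uV ->].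
  by rewrite divr1 mulr1.
by apply/exists_inP; exists w; rewrite // mulrDr trD cV.
Qed.

End Equiv.

(** * The roots of X^7 - X - 1 *)

Section Fields.
Variables (F : finFieldType) (h : nat).
Hypothesis cardF : #|F| = (2 ^ h)%N.
Let addff := addff cardF.
Implicit Types (a b c x y z : F) (s t : seq F) (m : bitseq).

Lemma frob_inj k : injective (fun x : F => x ^+ (2 ^ k)).
Proof.
move=> x y; elim: k => [//|k IH]; rewrite !expnSr !exprM.
by move/(sqrf_inj cardF)/IH.
Qed.

Lemma sqr_fix01 x : x ^+ 2 = x -> x != 0 -> x = 1.
Proof. by move=> E x0; apply: (mulIf x0); rewrite -expr2 E mul1r. Qed.

(** As 7 is prime, a coincidence of two conjugates makes [x] fixed under squaring, so that x is 0 or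
    1. *)
Lemma frob7_inj x : x ^+ (2 ^ 7) = x -> x != 0 -> x != 1 ->
  injective (fun i : 'I_7 => x ^+ (2 ^ i)).
Proof.
move=> x7 x0 x1 i j; wlog le_ij : i j / (i <= j)%N.
  by move=> W E; case/orP: (leq_total i j) => /W; [exact | move=> /(_ (esym E))].
move=> /= E; apply/val_inj/eqP; rewrite /= eqn_leq le_ij leqNgt; apply/negP => lt_ij.
have : x ^+ (2 ^ (j - i)) = x.
  by apply: (@frob_inj i); rewrite -exprM -expnD subnK.
move=> /(exprn_fix_gcd x7); have -> : gcdn 7 (j - i) = 1%N.
  apply/eqP; rewrite -/(coprime 7 (j - i)) prime_coprime //.
  apply/negP => /dvdn_leq; have := ltn_ord j; lia.
by move/sqr_fix01 => /(_ x0)/eqP; rewrite (negbTE x1).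
Qed.

(** A polynomial over F_2 of degree at most 6 vanishing at [x] also vanishes at its seven
    conjugates, so it is 0. The order of the list is that of [basis_change]: the last three entries
    are the products of pairs from x, x^2, x^4. *)
Lemma powers_indep x : x ^+ (2 ^ 7) = x -> x != 0 -> x != 1 ->
  indep [:: x; x ^+ 2; x ^+ 4; 1; x ^+ 3; x ^+ 5; x ^+ 6].
Proof.
move=> x7 x0 x1 [|m1 [|m2 [|m4 [|m0 [|m3 [|m5 [|m6 []]]]]]]] // _ /= H.
pose p : {poly F} := Poly [:: m0%:R; m1%:R; m2%:R; m3%:R; m4%:R; m5%:R; m6%:R].
have pE y : p.[y] = y *+ m1 + y ^+ 2 *+ m2 + y ^+ 4 *+ m4 + m0%:R + y ^+ 3 *+ m3
    + y ^+ 5 *+ m5 + y ^+ 6 *+ m6.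
  by rewrite horner_Poly /=; move: m0 m1 m2 m3 m4 m5 m6 {p H} => [] [] [] [] [] [] [] /=; ring.
have p_sqr y : p.[y ^+ 2] = p.[y] ^+ 2.
  rewrite !pE !(sqrfD cardF).
  by move: m0 m1 m2 m3 m4 m5 m6 {p H pE} => [] [] [] [] [] [] [] /=; ring.
have px i : p.[x ^+ (2 ^ i)] = 0.
  elim: i => [|i IH]; first by rewrite pE -[RHS]H addr0 !addrA.
  by rewrite expnSr exprM p_sqr IH expr0n.
have p0 : p = 0.
  apply/eqP; apply/negPn/negP => pn0.
  have := @card_roots_lt F p [set x ^+ (2 ^ i) | i : 'I_7] pn0.
  rewrite card_imset ?card_ord; last exact: frob7_inj.
  rewrite ltnNge (leq_trans (size_Poly _)) // => H7; have // : false.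
  by apply: H7 => _ /imsetP[i _ ->]; rewrite /root px.
have co i : nth 0 [:: m0%:R; m1%:R; m2%:R; m3%:R; m4%:R; m5%:R; m6%:R] i = 0 :> F.
  by rewrite -coef_Poly -/p p0 coef0.
have nat0 (b : bool) : b%:R = 0 :> F -> ~~ b by case: b => // /eqP; rewrite oner_eq0.
by rewrite (nat0 _ (co 0)) (nat0 _ (co 1)) (nat0 _ (co 2)) (nat0 _ (co 3)) (nat0 _ (co 4)) (nat0
  _ (co 5)) (nat0 _ (co 6)).
Qed.

(** Of the squares of the four elements, only x^8 is not already in the list. *)
Lemma admissible_powers x : x ^+ (2 ^ 7) = x -> x != 0 -> x != 1 ->
  x ^+ 8 \in spanset [:: x; x ^+ 2; x ^+ 4; 1] -> admissible x (x ^+ 2) (x ^+ 4) 1.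
Proof.
move=> x7 x0 x1 x8; apply/(admissibleP cardF); split; rewrite ?oner_neq0 //.
  have := powers_indep x7 x0 x1; rewrite -[_ :: _]/(rcons (rcons (rcons [:: _; _; _; _] _) _) _).
  by do 3![move/(indep_rcons cardF) => [+ _]].
move=> y; rewrite divr1 !inE => /or4P[] /eqP -> //.
- by rewrite spanset_mem // !inE eqxx orbT.
- by rewrite -exprM spanset_mem // !inE eqxx !orbT.
- by rewrite -exprM.
- by rewrite expr1n spanset_mem // !inE eqxx !orbT.
Qed.

Section Root7.
Variable z : F.
Hypothesis z7 : z ^+ 7 = z + 1.

Lemma root7_exp8 : z ^+ 8 = z ^+ 2 + z.
Proof. by rewrite exprS z7; ring. Qed.

Lemma root7_exp16 : z ^+ 16 = z ^+ 4 + z ^+ 2.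
Proof. by rewrite -[16%N]/(8 * 2)%N exprM root7_exp8 (sqrfD cardF) -exprM. Qed.

(** From z^8 = z^2 + z and its squares, z^128 = z^32 + z^16 = z^8 + z^2 = z. *)
Lemma root7_exp128 : z ^+ (2 ^ 7) = z.
Proof.
rewrite -[(2 ^ 7)%N]/(16 * (2 ^ 3))%N exprM root7_exp16 (frobD cardF) -!exprM.
rewrite -[(4 * 2 ^ 3)%N]/(16 * 2)%N -[(2 * 2 ^ 3)%N]/16%N exprM root7_exp16 (sqrfD cardF) -!exprM
  root7_exp8.
have -> : z ^+ 2 + z + z ^+ (2 * 2) + (z ^+ 4 + z ^+ 2) = z + (z ^+ 2 + z ^+ 2) + (z ^+ 4 + z ^+
  4) by ring.
by rewrite !addff !addr0.
Qed.

Lemma root7_neq0 : z != 0.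
Proof. by apply/eqP => z0; move: z7; rewrite z0 expr0n add0r => /esym/eqP; rewrite oner_eq0. Qed.

Lemma root7_neq1 : z != 1.
Proof. by apply/eqP => z1; move: z7; rewrite z1 expr1n addff => /eqP; rewrite oner_eq0. Qed.

Let w := z ^+ 11.

(** This explains the exponent 11: the Frobenius satisfies X^3 + X + 1 on [z], but X^3 + X^2 + 1 on
    z^11. Both sides are reduced to powers of [z] of exponent at most 6. *)
Lemma root7_pow11_exp8 : w ^+ 8 = w ^+ 4 + w.
Proof.
have w1 : w = z ^+ 5 + z ^+ 4 by rewrite /w -[11%N]/(8 + 3)%N exprD root7_exp8; ring.
have z20 : z ^+ 20 = z ^+ 6 + z ^+ 2 + z.
  by rewrite -[20%N]/(16 + 4)%N exprD root7_exp16 mulrDl -!exprD root7_exp8 addrC addrA.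
have w4 : w ^+ 4 = z ^+ 6 + z ^+ 4 + z.
  rewrite w1 -[4%N]/(2 ^ 2)%N (frobD cardF) -!exprM -[(5 * _)%N]/20%N -[(2 ^ 2 * _)%N]/16%N z20
    root7_exp16.
  have -> : z ^+ 6 + z ^+ 2 + z + (z ^+ 4 + z ^+ 2) = z ^+ 6 + z ^+ 4 + z + (z ^+ 2 + z ^+ 2) by
    ring.
  by rewrite addff addr0.
rewrite -[8%N]/(4 * 2)%N exprM w4 !(sqrfD cardF) -!exprM -[(4 * 2)%N]/8%N root7_exp8 w1.
have -> : z ^+ (6 * 2) = z ^+ 6 + z ^+ 5 by rewrite -[(6 * 2)%N]/(8 + 4)%N exprD root7_exp8; ring.
apply: (addff_eq cardF).
have -> : z ^+ 6 + z ^+ 5 + (z ^+ 2 + z) + z ^+ 2 + (z ^+ 6 + z ^+ 4 + z + (z ^+ 5 + z ^+ 4)) =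
  (z ^+ 6 + z ^+ 6) + (z ^+ 5 + z ^+ 5) + (z ^+ 4 + z ^+ 4) + (z ^+ 2 + z ^+ 2) + (z + z) by ring.
by rewrite !addff.
Qed.

Lemma root7_pow11_exp128 : w ^+ (2 ^ 7) = w.
Proof. by rewrite -exprM mulnC exprM root7_exp128. Qed.

Lemma root7_pow11_neq0 : w != 0. Proof. by rewrite expf_neq0 // root7_neq0. Qed.

Lemma root7_pow11_neq1 : w != 1.
Proof. by apply/eqP => w1; have := root7_pow11_exp8; rewrite w1 !expr1n addff => /eqP;
  rewrite oner_eq0. Qed.

Lemma admissible_root7 : admissible z (z ^+ 2) (z ^+ 4) 1.
Proof.
apply: admissible_powers; rewrite ?root7_exp128 ?root7_neq0 ?root7_neq1 // root7_exp8.
by apply: (spansetD cardF); apply: spanset_mem; rewrite !inE eqxx ?orbT.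
Qed.

Lemma admissible_root7_pow11 : admissible (z ^+ 11) (z ^+ 22) (z ^+ 44) 1.
Proof.
have -> : z ^+ 22 = w ^+ 2 by rewrite -exprM.
have -> : z ^+ 44 = w ^+ 4 by rewrite -exprM.
apply: admissible_powers; rewrite ?root7_pow11_exp128 ?root7_pow11_neq0 ?root7_pow11_neq1 //
  root7_pow11_exp8.
by apply: (spansetD cardF); apply: spanset_mem; rewrite !inE eqxx ?orbT.
Qed.

End Root7.

(** [L] divides ['X^(2 ^ 7) - 'X], which divides ['X^#|F| - 'X] as 7 divides [h]. So [L] has 8
    roots, and a nonzero one, divided out once, satisfies z^7 + z + 1 = 0. *)
Lemma root7_exists : (7 %| h)%N -> exists z, z ^+ 7 = z + 1.
Proof.
move=> h7; pose L : {poly F} := 'X^8 + 'X^2 + 'X.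
have A (p : {poly F}) : p + p = 0 by apply: addrr_pchar2; rewrite pchar_lalg (char2 cardF).
have N (p : {poly F}) : - p = p by apply: oppr_pchar2; rewrite pchar_lalg (char2 cardF).
have LX : L %| 'X^(2 ^ 7) - 'X.
  (* This is the factorisation X^7 + 1 = (X^3 + X + 1) (X^4 + X^2 + X + 1), with X^i replaced by the
     i-th iterate of squaring. *)
  have -> : 'X^(2 ^ 7) - 'X = L ^+ (2 ^ 4) + L ^+ (2 ^ 2) + L ^+ (2 ^ 1) + L.
    rewrite N /L !(frobD_poly cardF) -!exprM.
    rewrite -[(8 * 2 ^ 4)%N]/128%N -[(2 * 2 ^ 4)%N]/32%N -[(2 ^ 4)%N]/16%N -[(8 * 2 ^ 2)%N]/32%N
      -[(2 * 2 ^ 2)%N]/8%N -[(2 ^ 2)%N]/4%N -[(8 * 2 ^ 1)%N]/16%N -[(2 * 2 ^ 1)%N]/4%N -[(2 ^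
        1)%N]/2%N -[(2 ^ 7)%N]/128%N.
    move: ('X : {poly F}) ('X^2 : {poly F}) ('X^4 : {poly F}) ('X^8 : {poly F}) ('X^16 : {poly
      F}) ('X^32 : {poly F}) ('X^128 : {poly F}) => g f e d c b a.
    have -> : a + b + c + (b + d + e) + (c + e + f) + (d + f + g) =
       a + g + (b + b) + (c + c) + (d + d) + (e + e) + (f + f) by ring.
    by rewrite !A !addr0.
  by rewrite (dvdp_add (dvdp_add (dvdp_add _ _) _) (dvdpp L)) // dvdp_exp.
have sL : size L = 9.
  by rewrite /L -addrA size_polyDl size_polyXn // (leq_ltn_trans (size_polyD _ _)) // size_polyXn
    size_polyX.
have : #|[set x | root L x]| = 8.
  have := dvdp_trans LX (dvdp_frob_fix cardF h7).
  by rewrite -cardF => /card_roots_of_split; rewrite sL.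
move=> cL; have /subsetPn[z] : ~~ ([set x | root L x] \subset [set 0]).
  by apply/negP => /subset_leq_card; rewrite cL cards1.
rewrite !inE /root !hornerE /= => /eqP Lz z0; exists z.
apply: (addff_eq cardF); apply/eqP; rewrite -(mulrI_eq0 _ (mulfI z0)) -[X in _ == X]Lz;
  apply/eqP; ring.
Qed.

End Fields.

(** * Frobenius-stable subspaces of dimension 4 *)

Lemma sqr_mulrb (R : pzRingType) (x : R) (b : bool) : (x *+ b) ^+ 2 = x ^+ 2 *+ b.
Proof. by case: b; rewrite // !mulr0n expr0n. Qed.

Section Classification.
Variables (F : finFieldType) (h : nat).
Hypothesis cardF : #|F| = (2 ^ h)%N.
Let addff := addff cardF.
Implicit Types (a b x y z : F) (s t : seq F) (m : bitseq).

Lemma linE s m : lin m s = \sum_(j < size s) (nth false m j)%:R * nth 0 s j.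
Proof.
elim: s m => [|a s IH] [|b m]; rewrite ?big_ord0 //=.
  by rewrite big1 // => j _; rewrite nth_nil mul0r.
by rewrite big_ord_recl IH /= mulr_natl.
Qed.

(** Squaring acts on the column [a] of generators as a matrix [M] with entries 0, 1. Since Frobenius
    fixes [M], M^k a is the column of 2^k-th powers, and the characteristic polynomial has
    coefficients 0, 1. Cayley-Hamilton applied to [a] gives the relation on generators, and
    additivity extends it. *)
Lemma frobenius_relation s n : size s = n.+1 ->
  {in s, forall x, x ^+ 2 \in spanset s} ->
  exists c : nat -> bool, {in spanset s, forall w,
    w ^+ (2 ^ n.+1) = \sum_(k < n.+1) w ^+ (2 ^ k) *+ c k}.
Proof.
move=> sn sq; pose x0 := nth 0 s.
have /fin_all_exists[l lE] : forall i : 'I_n.+1, exists m, x0 i ^+ 2 = lin m s.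
  move=> i; have /sq/spansetP[m _ E] : x0 i \in s by rewrite mem_nth // sn.
  by exists m.
pose M : 'M[F]_n.+1 := \matrix_(i, j) (nth false (l i) j)%:R.
pose a : 'cV[F]_n.+1 := \col_i x0 i.
pose phi := pFrobenius_aut (char2 cardF).
have phiE x : phi x = x ^+ 2 by [].
have phi_nat (b : bool) : phi b%:R = b%:R by rewrite phiE; case: b; rewrite ?expr1n ?expr0n.
have phia : map_mx phi a = M *m a.
  apply/colP => i; rewrite !mxE phiE lE linE sn; apply: eq_bigr => j _.
  by rewrite !mxE.
have phiM : map_mx phi M = M by apply/matrixP => i j; rewrite !mxE phi_nat.
have powM k : M ^+ k *m a = \col_i (x0 i ^+ (2 ^ k)).
  elim: k => [|k IH]; first by rewrite expr0 mul1mx; apply/colP => i; rewrite !mxE.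
  rewrite exprSr -mulmxA -phia -[M ^+ k](_ : map_mx phi (M ^+ k) = _).
    by rewrite -map_mxM IH; apply/colP => i; rewrite !mxE expnSr exprM.
  by rewrite rmorphXn /= phiM.
pose p := char_poly M.
have sp : size p = n.+2 by exact: size_char_poly.
have p01 k : p`_k = (p`_k == 1)%:R.
  have : p`_k ^+ 2 = p`_k.
    by rewrite -[RHS](congr1 (fun A => (char_poly A)`_k) phiM) -map_char_poly coef_map.
  have [->|p0 /sqr_fix01 -> //] := eqVneq p`_k 0; last by rewrite eqxx.
  by rewrite eq_sym oner_eq0.
have p1 : p`_n.+1 = 1.
  by have := char_poly_monic M; rewrite monicE lead_coefE size_char_poly => /eqP.
exists (fun k => p`_k == 1).
(* [inord i] has value [i] only for [i <= n]; the second alternative covers the other indices, which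
   do not occur for elements of [s]. *)
have rel i : x0 i ^+ (2 ^ n.+1) = \sum_(k < n.+1) x0 i ^+ (2 ^ k) *+ (p`_k == 1) \/ (n < i)%N.
  case: (ltnP n i) => [|i_n]; [by right | left].
  have CH : \sum_(k < n.+2) p`_k *: M ^+ k = 0.
    rewrite -[RHS](Cayley_Hamilton M) -/p -[p in RHS]coefK poly_def sp linear_sum.
    by apply: eq_bigr => k _; rewrite linearZ rmorphXn /= horner_mx_X.
  have := congr1 (fun A => (A *m a) (inord i) 0) CH.
  rewrite mul0mx mulmx_suml summxE [RHS]mxE.
  rewrite (eq_bigr (fun k : 'I_n.+2 => x0 i ^+ (2 ^ k) *+ (p`_k == 1))) => [|k _].
    rewrite big_ord_recr /= p1 eqxx mulr1n => E.
    by apply/esym/(addff_eq cardF).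
  rewrite -scalemxAl powM !mxE inordK ?ltnS // [in LHS]p01.
  by rewrite mulr_natl.
move=> _ /spansetP[m sm ->]; apply/eqP.
pose G := [set w : F | w ^+ (2 ^ n.+1) == \sum_(k < n.+1) w ^+ (2 ^ k) *+ (p`_k == 1)].
suff : lin m s \in G by rewrite inE.
apply: lin_closed.
- rewrite inE expr0n expn_eq0 /= big1 // => k _.
  by rewrite expr0n expn_eq0 mul0rn.
- move=> x y; rewrite !inE => /eqP Ex /eqP Ey.
  rewrite (frobD cardF) Ex Ey -big_split; apply/eqP; apply: eq_bigr => k _.
  by rewrite (frobD cardF) mulrnDl.
move=> x /(nthP 0)[i]; rewrite sn ltnS => i_n <-; rewrite inE; apply/eqP.
by case: (rel i) => //; rewrite ltnNge i_n.
Qed.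

(** The roots of the additive polynomial attached to X^4 + c3 X^3 + c2 X^2 + c1 X + c0, where X
    stands for the Frobenius map. *)
Definition roots16 (c0 c1 c2 c3 : bool) : {set F} :=
  [set w | w ^+ 16 == w *+ c0 + w ^+ 2 *+ c1 + w ^+ 4 *+ c2 + w ^+ 8 *+ c3].

Lemma card_roots16 c0 c1 c2 c3 : (#|roots16 c0 c1 c2 c3| <= 16)%N.
Proof.
pose q : {poly F} := 'X^1 *+ c0 + 'X^2 *+ c1 + 'X^4 *+ c2 + 'X^8 *+ c3.
have sq : (size q < 17)%N.
  have szX n (e : bool) : (n < 16)%N -> (size (('X^n : {poly F}) *+ e)%R <= 16)%N.
    by case: e; rewrite ?mulr0n ?size_poly0 // size_polyXn.
  rewrite ltnS /q; do 3?[apply: leq_trans (size_polyD _ _) _; rewrite geq_max; apply/andP;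
    split]; exact: szX.
have sz : size ('X^16 - q) = 17 by rewrite size_polyDl size_polyXn // size_polyN.
suff: (#|roots16 c0 c1 c2 c3| < size ('X^16 - q)%R)%N by rewrite sz ltnS.
apply: card_roots_lt; first by rewrite -size_poly_eq0 sz.
move=> w; rewrite inE => /eqP E; rewrite /root !hornerE E !hornerMn !hornerE.
by rewrite subrr.
Qed.

Lemma span_eq_roots16 s (c0 c1 c2 c3 : bool) : indep s -> size s = 4 ->
  {in spanset s, forall w, w ^+ 16 = w *+ c0 + w ^+ 2 *+ c1 + w ^+ 4 *+ c2 + w ^+ 8 *+ c3} ->
  spanset s = roots16 c0 c1 c2 c3.
Proof.
move=> I s4 H; apply/eqP; rewrite eqEcard (card_spanset cardF) // s4 card_roots16 andbT.
by apply/subsetP => w /H E; rewrite inE E.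
Qed.

Lemma frobenius_cases s : indep s -> size s = 4 -> 1 \in spanset s ->
  {in s, forall x, x ^+ 2 \in spanset s} ->
  [\/ spanset s = roots16 true false false false,
      spanset s = roots16 true true false true,
      spanset s = roots16 true false true true
    | spanset s = roots16 true true true false].
Proof.
move=> I s4 s1 sq; have [c cE] := frobenius_relation s4 sq.
have E : spanset s = roots16 (c 0) (c 1) (c 2) (c 3).
  apply: span_eq_roots16 => // w /cE ->.
  by rewrite !big_ord_recr big_ord0 /= add0r.
(* Otherwise the additive polynomial is the square of [q], of degree 8, which has too few roots for
   a span of 16 elements. *)
have c0 : c 0.
  apply/negPn/negP => /negbTE c0.
  pose q : {poly F} := 'X^8 + ('X^1 *+ c 1 + 'X^2 *+ c 2 + 'X^4 *+ c 3).
  have sq8 : size q = 9.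
    rewrite size_polyDl size_polyXn // ltnS.
    have szX n (e : bool) : (n < 8)%N -> (size (('X^n : {poly F}) *+ e)%R <= 8)%N.
      by case: e; rewrite ?mulr0n ?size_poly0 // size_polyXn.
    do 2?[apply: leq_trans (size_polyD _ _) _; rewrite geq_max; apply/andP; split]; exact: szX.
  have : (#|spanset s| < size q)%N.
    apply: card_roots_lt; first by rewrite -size_poly_eq0 sq8.
    move=> w; rewrite E inE c0 mulr0n add0r => /eqP Ew.
    rewrite /root /q !hornerE !hornerMn !hornerE; apply/eqP/(sqrf_inj cardF).
    rewrite !(sqrfD cardF) !sqr_mulrb -!exprM expr0n -[(8 * 2)%N]/16%N Ew.
    by apply: etrans (addff (w ^+ 2 *+ c 1 + w ^+ 4 *+ c 2 + w ^+ 8 *+ c 3)); rewrite !addrA.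
  by rewrite (card_spanset cardF) // s4 sq8.
(* At w = 1 the relation says that an even number of c1, c2, c3 are set, which leaves four cases. *)
move: s1; rewrite {1}E c0 inE !expr1n.
case: (c 1) (c 2) (c 3) E => [] [] [] E; rewrite ?c0 /= ?mulr1n ?mulr0n ?addr0 ?addff ?add0r
  ?addff ?oner_eq0 ?(eq_sym 1 0) ?oner_eq0 // => _.
all: by rewrite c0 in E; (constructor 1 + constructor 2 + constructor 3 + constructor 4); exact: E.
Qed.

Definition frob_fixed d : {set F} := [set x | x ^+ (2 ^ d) == x].

Lemma frob_fixed_subfield d : (0 < d)%N -> (d %| h)%N -> is_subfield (2 ^ d) (frob_fixed d).
Proof.
move=> d0 dh; split; last exact: (card_frob_fix cardF).
split; first by rewrite inE expr1n.
  move=> x y; rewrite !inE !(oppf2 cardF) (frobD cardF) => /eqP -> /eqP ->; exact: eqxx.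
by move=> x y; rewrite !inE exprMn exprVn => /eqP -> /eqP ->.
Qed.

Lemma frob_fixed_gcd d : {in frob_fixed d, forall x, x ^+ (2 ^ gcdn d h) = x}.
Proof. by move=> x; rewrite inE => /eqP /exprn_fix_gcd; apply; rewrite (frob_fix cardF). Qed.

Lemma F16_roots : roots16 true false false false = frob_fixed 4.
Proof. by apply/setP => x; rewrite !inE /= mulr1n !mulr0n !addr0. Qed.

Lemma roots16_add c0 c1 c2 c3 : {in roots16 c0 c1 c2 c3 &, forall x y, x + y \in roots16 c0 c1 c2
  c3}.
Proof.
move=> x y; rewrite !inE => /eqP Ex /eqP Ey.
rewrite (frobD cardF 4) (frobD cardF 3) (frobD cardF 2) (frobD cardF 1) Ex Ey !mulrnDl.
by apply/eqP; ring.
Qed.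

(** Both fields lie in the root set, so their span has order at most 16. It properly contains the
    field of order 8, because the two fields meet in F_2; its order is a multiple of 8, hence 16. *)
Lemma F4_F8_roots : (6 %| h)%N ->
  add_span (frob_fixed 2 :|: frob_fixed 3) = roots16 true true false true /\ #|roots16 true true
    false true| = 16.
Proof.
move=> h6; have h2 : (2 %| h)%N by apply: dvdn_trans h6.
have h3 : (3 %| h)%N by apply: dvdn_trans h6.
have grp c0 c1 c2 c3 : group_set (roots16 c0 c1 c2 c3).
  apply/group_setP; split; last exact: roots16_add.
  by rewrite inE !expr0n /= !mul0rn !addr0.
have grpK d : group_set (frob_fixed d).
  apply/group_setP; split=> [|x y]; first by rewrite inE expr0n expn_eq0.
  by rewrite !inE (frobD cardF) => /eqP -> /eqP ->.
pose R := Group (grp true true false true); pose K8 := Group (grpK 3).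
pose S := <<frob_fixed 2 :|: frob_fixed 3>>%G.
have SR : S \subset R.
  rewrite gen_subG; apply/subsetP => x; rewrite !inE /= !mulr1n mulr0n addr0 => /orP[] /eqP E.
    have E8 : x ^+ 8 = x ^+ 2 by rewrite -[8%N]/(2 ^ 2 * 2)%N exprM E.
    have E16 : x ^+ 16 = x by rewrite -[16%N]/(2 ^ 2 * 2 ^ 2)%N exprM E.
    by rewrite E8 E16 -addrA addff addr0.
  have E16 : x ^+ 16 = x ^+ 2 by rewrite -[16%N]/(2 ^ 3 * 2)%N exprM E.
  by rewrite E16 E addrAC addff add0r.
have c8 : #|K8| = 8 by rewrite (card_frob_fix cardF).
have K8S : K8 \subset S by apply: subset_trans (subset_gen _); exact: subsetUr.
have [x x4 x8] : exists2 x, x \in frob_fixed 2 & x \notin frob_fixed 3.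
  apply/subsetPn/negP => K48.
  suff : (#|frob_fixed 2| <= 2 ^ 1)%N by rewrite (card_frob_fix cardF).
  apply: card_frob_fix_le => // x x2; have := subsetP K48 _ x2; move: x2.
  by rewrite !inE => /eqP x2 /eqP x3; exact: (exprn_fix_gcd x2 x3).
have xS : x \in S by apply: mem_gen; rewrite inE x4.
have SR16 : #|S| = 16.
  have le : (#|S| <= 16)%N by apply: leq_trans (subset_leq_card SR) (card_roots16 _ _ _ _).
  have /dvdnP[k kS] := cardSg K8S; rewrite c8 in kS.
  have : (#|K8| < #|S|)%N.
    apply: proper_card; rewrite properE K8S; apply/subsetPn; exists x => //.
  rewrite c8; lia.
have RS : S :=: R by apply/eqP; rewrite eqEcard SR SR16 card_roots16.
by split; [exact: RS | rewrite -[RHS]SR16; congr #|pred_of_set _|; rewrite RS].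
Qed.

End Classification.

Lemma PGammaL_equiv_trans (F : finFieldType) (A B C : {set {set 'rV[F]_3}}) :
  PGammaL_equiv A B -> PGammaL_equiv B C -> PGammaL_equiv A C.
Proof.
move=> [s1 [M1 [U1 ->]]] [s2 [M2 [U2 ->]]].
exists (s2 \o s1), (map_mx s2 M1 *m M2); split.
  by rewrite unitmx_mul map_unitmx U1.
rewrite -imset_comp; apply: eq_imset => P /=; rewrite /collineation -imset_comp.
by apply: eq_imset => v /=; rewrite map_mxM -map_mx_comp mulmxA.
Qed.

(** * Bases of the listed spans, and divisibility of the degree [h] *)

Section Final.
Variables (F : finFieldType) (h : nat).
Hypothesis cardF : #|F| = (2 ^ h)%N.
Let addff := addff cardF.
Implicit Types (a b x y z : F) (s t : seq F) (m : bitseq).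

(** The element 1 is extended to a basis of [V] and then moved to the last place; with a4 = 1,
    admissibility is stability under squaring. *)
Lemma admissible_of_set (V : {set F}) : 1 \in V -> 0 \in V ->
  {in V &, forall x y, x + y \in V} -> {in V, forall x, x ^+ 2 \in V} ->
  #|V| = 16 ->
  exists a1 a2 a3, admissible a1 a2 a3 1 /\ spanset [:: a1; a2; a3; 1] = V.
Proof.
move=> V1 V0 VD VX V16.
have sub s : {subset s <= V} -> spanset s \subset V.
  by move=> sV; apply/subsetP => _ /spansetP[m _ ->]; exact: lin_closed.
have ext s : indep s -> {subset s <= V} -> (size s < 4)%N ->
    exists2 x, indep (rcons s x) & {subset rcons s x <= V}.
  move=> I sV s4; have /subsetPn[x xV xs] : ~~ (V \subset spanset s).
    apply/negP => /subset_leq_card; rewrite V16 (card_spanset cardF) //.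
    by rewrite (@leq_exp2l 2 4) // leqNgt s4.
  exists x; first by apply/(indep_rcons cardF).
  by move=> y; rewrite mem_rcons inE => /orP[/eqP ->|/sV].
have I1 : indep [:: 1 : F].
  by move=> [|b []] // _ /=; case: b; rewrite // addr0 => /eqP; rewrite oner_eq0.
have [|//|a1 Ia1 sa1] := ext _ I1; first by move=> x; rewrite inE => /eqP ->.
have [//|a2 Ia2 sa2] := ext _ Ia1 sa1.
have [//|a3 Ia3 sa3] := ext _ Ia2 sa2.
have EV : spanset [:: a1; a2; a3; 1] = V.
  apply/eqP; rewrite eqEsubset sub /=; last first.
    by move=> x xs; apply: sa3; move: xs; rewrite !inE; case/or4P => ->; rewrite ?orbT.
  have -> : V = spanset [:: 1; a1; a2; a3].
    by apply/esym/eqP; rewrite eqEcard V16 (card_spanset cardF) // sub.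
  apply: (spanset_sub cardF) => x xs; apply: spanset_mem.
  by move: xs; rewrite !inE; case/or4P => ->; rewrite ?orbT.
exists a1, a2, a3; split=> //; apply/(admissibleP cardF); split.
- by apply: indep_card; rewrite EV V16.
- exact: oner_neq0.
by move=> x xs; rewrite divr1 EV VX // -EV spanset_mem.
Qed.

Lemma roots16_sqr c0 c1 c2 c3 : {in roots16 F c0 c1 c2 c3, forall x, x ^+ 2 \in roots16 F c0 c1
  c2 c3}.
Proof.
move=> x; rewrite !inE => /eqP E; rewrite exprAC E !(sqrfD cardF) !sqr_mulrb.
by apply/eqP; rewrite -!exprM.
Qed.

Lemma admissible_of_roots16 c0 c1 c2 c3 : #|roots16 F c0 c1 c2 c3| = 16 ->
  1 \in roots16 F c0 c1 c2 c3 ->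
  exists a1 a2 a3, admissible a1 a2 a3 1 /\ spanset [:: a1; a2; a3; 1] = roots16 F c0 c1 c2 c3.
Proof.
move=> c16 r1; apply: admissible_of_set => //.
- by rewrite inE !expr0n /= !mul0rn !addr0.
- exact: (roots16_add cardF).
- exact: roots16_sqr.
Qed.

Lemma exists_F16 : (4 %| h)%N ->
  exists a1 a2 a3 : F, admissible a1 a2 a3 1 /\ spans_F16 a1 a2 a3 1.
Proof.
move=> h4; have [||a1 [a2 [a3 [adm E]]]] := @admissible_of_roots16 true false false false.
- by rewrite F16_roots (card_frob_fix cardF).
- by rewrite inE !expr1n /= !mulr0n !addr0.
exists a1, a2, a3; split=> //; exists (frob_fixed F 4); first exact: (frob_fixed_subfield cardF).
by rewrite (span4E cardF) E F16_roots.
Qed.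

Lemma exists_F4_F8 : (6 %| h)%N ->
  exists a1 a2 a3 : F, admissible a1 a2 a3 1 /\ spans_F4_F8 a1 a2 a3 1.
Proof.
move=> h6; have [E c16] := F4_F8_roots cardF h6.
have [//||a1 [a2 [a3 [adm E']]]] := @admissible_of_roots16 true true false true.
  by rewrite inE !expr1n /= !mulr1n mulr0n addff add0r add0r.
exists a1, a2, a3; split=> //; exists (frob_fixed F 2), (frob_fixed F 3); split.
- by apply: (frob_fixed_subfield cardF) => //; apply: dvdn_trans h6.
- by apply: (frob_fixed_subfield cardF) => //; apply: dvdn_trans h6.
- by rewrite (span4E cardF) E E'.
Qed.

(** The additive form of the fact that X^4 + X^3 + X + 1 divides X^6 + 1, obtained by squaring the
    relation twice. *)
Lemma roots16_fix6 x : x \in roots16 F true true false true -> x ^+ (2 ^ 6) = x.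
Proof.
rewrite inE /= !mulr1n mulr0n addr0 => /eqP x16.
have x32 : x ^+ 32 = x ^+ 2 + x ^+ 4 + x ^+ 16 by rewrite (exprM x 16 2) [in LHS]x16 !(sqrfD
  cardF) -!exprM.
rewrite (exprM x 32 2) x32 !(sqrfD cardF) -!exprM -[(16 * 2)%N]/32%N x32 x16.
rewrite -[(2 * 2)%N]/4%N -[(4 * 2)%N]/8%N.
have -> : x ^+ 4 + x ^+ 8 + (x ^+ 2 + x ^+ 4 + (x + x ^+ 2 + x ^+ 8)) =
  x + (x ^+ 2 + x ^+ 2) + (x ^+ 4 + x ^+ 4) + (x ^+ 8 + x ^+ 8) by ring.
by rewrite !addff !addr0.
Qed.

(** The bit [c1] selects X^4 + X^2 + X + 1 or X^4 + X^3 + X^2 + 1; both divide X^7 + 1. *)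
Lemma roots16_fix7 x c1 : x \in roots16 F true c1 true (~~ c1) -> x ^+ (2 ^ 7) = x.
Proof.
rewrite inE; case: c1; rewrite /= !mulr1n mulr0n addr0 => /eqP x16.
  have x32 : x ^+ 32 = x ^+ 2 + x ^+ 4 + x ^+ 8 by rewrite (exprM x 16 2) [in LHS]x16 !(sqrfD
    cardF) -!exprM.
  have x64 : x ^+ 64 = x ^+ 4 + x ^+ 8 + x ^+ 16 by rewrite (exprM x 32 2) [in LHS]x32 !(sqrfD
    cardF) -!exprM.
  rewrite (exprM x 64 2) x64 !(sqrfD cardF) -!exprM -[(16 * 2)%N]/32%N x32.
  rewrite -[(8 * 2)%N]/16%N x16 -[(4 * 2)%N]/8%N.
  have -> : x ^+ 8 + (x + x ^+ 2 + x ^+ 4) + (x ^+ 2 + x ^+ 4 + x ^+ 8) =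
    x + (x ^+ 2 + x ^+ 2) + (x ^+ 4 + x ^+ 4) + (x ^+ 8 + x ^+ 8) by ring.
  by rewrite !addff !addr0.
have x32 : x ^+ 32 = x ^+ 2 + x ^+ 8 + x ^+ 16 by rewrite (exprM x 16 2) [in LHS]x16 !(sqrfD
  cardF) -!exprM.
have x64 : x ^+ 64 = x ^+ 4 + x ^+ 16 + x ^+ 32 by rewrite (exprM x 32 2) [in LHS]x32 !(sqrfD
  cardF) -!exprM.
rewrite (exprM x 64 2) x64 !(sqrfD cardF) -!exprM -[(16 * 2)%N]/32%N -[(32 * 2)%N]/64%N x64 x16.
rewrite -[(4 * 2)%N]/8%N.
have -> : x ^+ 8 + x ^+ 32 + (x ^+ 4 + (x + x ^+ 4 + x ^+ 8) + x ^+ 32) =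
  x + (x ^+ 4 + x ^+ 4) + (x ^+ 8 + x ^+ 8) + (x ^+ 32 + x ^+ 32) by ring.
by rewrite !addff !addr0.
Qed.

(** All of [V] is fixed by the power 2^g with g = [gcdn d h], so 16 <= 2^g and g >= 4. As g divides
    d < 8, it equals d. *)
Lemma dvdn_of_fix d (V : {set F}) : (0 < d < 8)%N -> #|V| = 16 ->
  {in V, forall w, w ^+ (2 ^ d) = w} -> (d %| h)%N.
Proof.
move=> /andP[d0 d8] V16 Vd.
have g0 : (0 < gcdn d h)%N by rewrite gcdn_gt0 d0.
have := @card_frob_fix_le F (gcdn d h) V g0.
rewrite V16 (@leq_exp2l 2 4) // => /(_ _)g4.
have {}g4 : (4 <= gcdn d h)%N.
  by apply: g4 => x xV; apply: frob_fixed_gcd => //; rewrite inE Vd.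
have /dvdnP[k dk] := dvdn_gcdl d h.
have k1 : k = 1%N by nia.
by rewrite dk k1 mul1n dvdn_gcdr.
Qed.

Hypothesis h_gt5 : (5 < h)%N.

(** The span contains [x], x^2 and x^4 by stability, and with 1 they form a basis of it;
    [powers_indep] supplies the seven independent elements for [basis_change]. *)
Lemma equiv_of_root7 x a1 a2 a3 A : admissible x (x ^+ 2) (x ^+ 4) 1 ->
  x ^+ (2 ^ 7) = x -> x != 0 -> x != 1 ->
  x \in spanset [:: a1; a2; a3; 1] ->
  {in spanset [:: a1; a2; a3; 1], forall y, y ^+ 2 \in spanset [:: a1; a2; a3; 1]} ->
  constructed_from a1 a2 a3 1 A ->
  equiv_to_constructed x (x ^+ 2) (x ^+ 4) 1 A.
Proof.
move=> adm x7 x0 x1 xV VX cA; have /(admissibleP cardF)[I _ _] := adm.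
apply: (basis_change cardF h_gt5 adm _ _ cA).
  apply: (eq_spanset cardF) => // y; rewrite !inE => /or4P[] /eqP -> //.
  - exact: VX.
  - by rewrite -[4%N]/(2 * 2)%N exprM; apply/VX/VX.
  - by rewrite spanset_mem // !inE eqxx !orbT.
by rewrite -!exprD -exprS; exact: (powers_indep cardF).
Qed.

End Final.

Theorem theorem5p11 (h : nat) (F : finFieldType)
    (h_gt5 : (5 < h)%N) (cardF : #|F| = (2 ^ h)%N) :
  (forall A : {set {set 'rV[F]_3}}, arises_from_construction A ->
     KM_arc (#|F| %/ 16) A /\
     [\/ (4 %| h)%N /\
           (exists a1 a2 a3 : F,
              spans_F16 a1 a2 a3 1 /\ equiv_to_constructed a1 a2 a3 1 A),
         (6 %| h)%N /\
           (exists a1 a2 a3 : F,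
              spans_F4_F8 a1 a2 a3 1 /\ equiv_to_constructed a1 a2 a3 1 A)
       | (7 %| h)%N /\
           (exists z : F, z ^+ 7 = z + 1 /\
              (equiv_to_constructed z (z ^+ 2) (z ^+ 4) 1 A \/
               equiv_to_constructed (z ^+ 11) (z ^+ 22) (z ^+ 44) 1 A))]) /\
  [/\ (4 %| h)%N ->
        exists a1 a2 a3 : F,
          [/\ admissible a1 a2 a3 1, spans_F16 a1 a2 a3 1
            & exists A, constructed_from a1 a2 a3 1 A],
      (6 %| h)%N ->
        exists a1 a2 a3 : F,
          [/\ admissible a1 a2 a3 1, spans_F4_F8 a1 a2 a3 1
            & exists A, constructed_from a1 a2 a3 1 A]
    & (7 %| h)%N ->
        (exists z : F, z ^+ 7 = z + 1) /\
        (forall z : F, z ^+ 7 = z + 1 ->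
           [/\ admissible z (z ^+ 2) (z ^+ 4) 1,
               exists A, constructed_from z (z ^+ 2) (z ^+ 4) 1 A,
               admissible (z ^+ 11) (z ^+ 22) (z ^+ 44) 1
             & exists A, constructed_from (z ^+ 11) (z ^+ 22) (z ^+ 44) 1 A])].
Proof.
split; last first.
  split=> [h4|h6|h7].
  - have [a1 [a2 [a3 [adm E]]]] := exists_F16 cardF h4.
    by exists a1, a2, a3; split=> //; exact: (constructed_exists cardF adm).
  - have [a1 [a2 [a3 [adm E]]]] := exists_F4_F8 cardF h6.
    by exists a1, a2, a3; split=> //; exact: (constructed_exists cardF adm).
  split; first exact: (root7_exists cardF h7).
  move=> z z7; have admz := admissible_root7 cardF z7; have admw := admissible_root7_pow11 cardF z7.
  by split=> //; [exact: (constructed_exists cardF admz) | exact: (constructed_exists cardF admw)].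
move=> A [a1 [a2 [a3 [a4 cA]]]]; split.
  case: (cA) => adm [a [b1 [b2 [b3 [ac bc ->]]]]].
  exact: (KM_set_arc cardF h_gt5 adm ac bc).
(* From here on the tuple ends in 1, and the equivalence with the given arc is restored by
   transitivity. *)
have [B cB AB] := constructed_scale cardF h_gt5 cA.
move: (a1 / a4) (a2 / a4) (a3 / a4) cB => {cA}a1 {}a2 {}a3 cB.
have [adm _] := cB; have /(admissibleP cardF)[I _ sq] := adm.
have s1 : 1 \in spanset [:: a1; a2; a3; 1] by rewrite spanset_mem // !inE eqxx !orbT.
have V16 := card_spanset cardF I.
have Vsq c0 c1 c2 c3 : spanset [:: a1; a2; a3; 1] = roots16 F c0 c1 c2 c3 ->
  {in spanset [:: a1; a2; a3; 1], forall y, y ^+ 2 \in spanset [:: a1; a2; a3; 1]}.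
  by move=> ->; exact: (roots16_sqr cardF).
have h7P : {in spanset [:: a1; a2; a3; 1], forall w, w ^+ (2 ^ 7) = w} ->
  (7 %| h)%N by exact: (dvdn_of_fix cardF _ V16).
case: (frobenius_cases cardF I erefl s1) => [x xs|E|E|E|E].
- by rewrite -[x ^+ 2]divr1; exact: sq.
- have h4 : (4 %| h)%N.
    apply: (dvdn_of_fix cardF _ V16) => // w; rewrite E F16_roots inE => /eqP //.
  constructor 1; split=> //; exists a1, a2, a3; split; last by exists B.
  exists (frob_fixed F 4); first exact: (frob_fixed_subfield cardF).
  by rewrite (span4E cardF) E F16_roots.
- have h6 : (6 %| h)%N.
    by apply: (dvdn_of_fix cardF _ V16) => // w; rewrite E; exact: (roots16_fix6 cardF).
  constructor 2; split=> //; exists a1, a2, a3; split; last by exists B.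
  exists (frob_fixed F 2), (frob_fixed F 3); split.
  + by apply: (frob_fixed_subfield cardF) => //; apply: dvdn_trans h6.
  + by apply: (frob_fixed_subfield cardF) => //; apply: dvdn_trans h6.
  + by rewrite (span4E cardF) E; case: (F4_F8_roots cardF h6).
- have h7 : (7 %| h)%N.
    by apply: h7P => w; rewrite E; exact: (roots16_fix7 cardF (c1 := false)).
  have [z z7] := root7_exists cardF h7.
  constructor 3; split=> //; exists z; split=> //; left.
  have [C cC BC] : equiv_to_constructed z (z ^+ 2) (z ^+ 4) 1 B.
    apply: (equiv_of_root7 cardF h_gt5 (admissible_root7 cardF z7) _ _ _ _ _ cB).
    + exact: (root7_exp128 cardF z7).
    + exact: (root7_neq0 z7).
    + exact: (root7_neq1 cardF z7).
    (* Any root [z] lies in the span, which is the full root set: z^16 = z^4 + z^2 = z + z^4 +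
       z^8. *)
    + rewrite E inE /= !mulr1n mulr0n addr0 (root7_exp16 cardF z7) (root7_exp8 z7).
      by rewrite [z ^+ 2 + z]addrC addrACA (addff cardF) add0r.
    + exact: (Vsq _ _ _ _ E).
  exists C => //; exact: (PGammaL_equiv_trans AB BC).
- have h7 : (7 %| h)%N.
    by apply: h7P => w; rewrite E; exact: (roots16_fix7 cardF (c1 := true)).
  have [z z7] := root7_exists cardF h7.
  constructor 3; split=> //; exists z; split=> //; right.
  have [C cC BC] : equiv_to_constructed (z ^+ 11) ((z ^+ 11) ^+ 2) ((z ^+ 11) ^+ 4) 1 B.
    apply: (equiv_of_root7 cardF h_gt5 _ _ _ _ _ _ cB).
    + by rewrite -!exprM; exact: (admissible_root7_pow11 cardF z7).
    + exact: (root7_pow11_exp128 cardF z7).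
    + exact: (root7_pow11_neq0 z7).
    + exact: (root7_pow11_neq1 cardF z7).
    (* For w = z^11, squaring w^8 = w^4 + w gives w^16 = w^8 + w^2 = w + w^2 + w^4. *)
    + rewrite E inE /= !mulr1n mulr0n addr0 (exprM _ 8 2) (root7_pow11_exp8 cardF z7) (sqrfD cardF).
      by rewrite -(exprM _ 4 2) (root7_pow11_exp8 cardF z7) -addrA addrC.
    + exact: (Vsq _ _ _ _ E).
  exists C; last exact: (PGammaL_equiv_trans AB BC).
  by move: cC; rewrite -!exprM.
Qed.
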